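(* Let $K\ge 1$ and $d\ge 1$ be integers, let $U_k\subset\mathbb{R}^d$ for $k=1,\ldots,K$, and let $\phi=(\phi_1,\phi_2,\ldots):\mathbb{R}^d\to\ell_2$ be a feature mapping. For $r\in\mathbb{N}$ let $\phi^{(r)}(\mathbf{u})=[\phi_1(\mathbf{u}),\ldots,\phi_r(\mathbf{u})]$ denote the first $r$ coordinates of $\phi(\mathbf{u})$, and define covariance functions on $U_k\times U_k$ by $$\Sigma^{(k)}_r(\mathbf{u},\mathbf{v})=\langle\phi^{(r)}(\mathbf{u}),\phi^{(r)}(\mathbf{v})\rangle,\qquad \Sigma^{(k)}(\mathbf{u},\mathbf{v})=\langle\phi(\mathbf{u}),\phi(\mathbf{v})\rangle_{\ell_2}.$$ For each $r$, let $\mathcal{W}^{(r)}\in\mathbb{R}^{r\times\cdots\times r}$ ($K$ modes) be a random tensor and define the random multilinear function $$g^{(r)}(\mathbf{u}^{(1)},\ldots,\mathbf{u}^{(K)})=\mathcal{W}^{(r)}\times_1\phi^{(r)}(\mathbf{u}^{(1)})\times_2\cdots\times_K\phi^{(r)}(\mathbf{u}^{(K)}),\qquad \mathbf{u}^{(k)}\in U_k.$$ If $\mathcal{W}^{(r)}\sim\mathcal{TN}(0,\{\mathbf{I}_r\}_{k=1}^K)$ for every $r$, then for every $r$ the random function $g^{(r)}$ follows the tensor-variate Gaussian distribution $\mathcal{TN}(0,\{\Sigma^{(k)}_r\}_{k=1}^K)$ (that is, for all finite families of locations $\mathbf{u}^{(k)}_1,\ldots,\mathbf{u}^{(k)}_{n_k}\in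 U_k$, $k=1,\ldots,K$, the random tensor $[g^{(r)}(\mathbf{u}^{(1)}_{j_1},\ldots,\mathbf{u}^{(K)}_{j_K})]_{j_1,\ldots,j_K}$ has law $\mathcal{TN}(0,\{\boldsymbol{\Sigma}^{(k)}_r\}_{k=1}^K)$ with $(\boldsymbol{\Sigma}^{(k)}_r)_{ij}=\Sigma^{(k)}_r(\mathbf{u}^{(k)}_i,\mathbf{u}^{(k)}_j)$), and as $r\to\infty$ the functions $g^{(r)}$ converge in distribution to the tensor-variate Gaussian process $\mathcal{TGP}(0,\{\Sigma^{(k)}\}_{k=1}^K)$.
   Context: Mode products: for $\mathcal{W}\in\mathbb{R}^{r_1\times\cdots\times r_K}$ and $\mathbf{U}\in\mathbb{R}^{n\times r_k}$, the mode-$k$ product $\mathcal{W}\times_k\mathbf{U}\in\mathbb{R}^{r_1\times\cdots\times r_{k-1}\times n\times r_{k+1}\times\cdots\times r_K}$ has entries $(\mathcal{W}\times_k\mathbf{U})_{i_1\ldots i_{k-1}\,j\,i_{k+1}\ldots i_K}=\sum_{i_k=1}^{r_k}w_{i_1\ldots i_K}u_{j i_k}$. A vector $\phi^{(r)}(\mathbf{u})$ is treated as a $1\times r$ matrix, so that $g^{(r)}(\mathbf{u}^{(1)},\ldots,\mathbf{u}^{(K)})=\sum_{i_1,\ldots,i_K=1}^r w^{(r)}_{i_1\ldots i_K}\prod_{k=1}^K\phi_{i_k}(\mathbf{u}^{(k)})$ is a scalar. Vectorization: for $\mathcal{M}\in\mathbb{R}^{n_1\times\cdots\times n_K}$, $\mathrm{vec}(\mathcal{M})\in\mathbb{R}^{n}$,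 $n=\prod_k n_k$, places entry $(i_1,\ldots,i_K)$ at position $i_K+\sum_{k=1}^{K-1}(i_k-1)\prod_{l=k+1}^K n_l$. Tensor-variate normal distribution: for $n_k\times n_k$ covariance matrices $\boldsymbol{\Sigma}^{(k)}$, a random tensor $\mathcal{M}\in\mathbb{R}^{n_1\times\cdots\times n_K}$ has law $\mathcal{TN}(0,\{\boldsymbol{\Sigma}^{(k)}\}_{k=1}^K)$ if $\mathrm{vec}(\mathcal{M})\sim\mathcal{N}(0,\boldsymbol{\Sigma}^{(1)}\otimes\cdots\otimes\boldsymbol{\Sigma}^{(K)})$ ($\otimes$ the Kronecker product; a possibly degenerate Gaussian if some $\boldsymbol{\Sigma}^{(k)}$ is singular). When all $\boldsymbol{\Sigma}^{(k)}$ are nonsingular this is the law with density $(2\pi)^{-n/2}\prod_{k=1}^K|\boldsymbol{\Sigma}^{(k)}|^{-n/(2n_k)}\exp\{-\tfrac12\|\mathcal{M}\times_1(\boldsymbol{\Sigma}^{(1)})^{-1/2}\times_2\cdots\times_K(\boldsymbol{\Sigma}^{(K)})^{-1/2}\|^2\}$, where $\|\mathcal{A}\|^2$ is the sum of squared entries of $\mathcal{A}$. $\mathbf{I}_r$ is the $r\times r$ identity matrix. Tensor-variate Gaussian process: a random function $f:U_1\times\cdots\times U_K\to\mathbb{R}$ follows $\mathcal{TGP}(0,\{\Sigma^{(k)}\}_{k=1}^K)$, with covariance functions $\Sigma^{(k)}:U_k\times U_k\to\mathbb{R}$, if for all finite families $\{\mathbf{u}^{(k)}_1,\ldots,\mathbf{u}^{(k)}_{n_k}\}\subset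 U_k$, $k=1,\ldots,K$, the random tensor $[f(\mathbf{u}^{(1)}_{j_1},\ldots,\mathbf{u}^{(K)}_{j_K})]_{j_1,\ldots,j_K}\in\mathbb{R}^{n_1\times\cdots\times n_K}$ has law $\mathcal{TN}(0,\{\boldsymbol{\Sigma}^{(k)}\}_{k=1}^K)$ with $\boldsymbol{\Sigma}^{(k)}_{ij}=\Sigma^{(k)}(\mathbf{u}^{(k)}_i,\mathbf{u}^{(k)}_j)$. Convergence in distribution of random functions on $U_1\times\cdots\times U_K$ to such a process means convergence in distribution of the random tensors obtained by evaluation on every such finite family of locations. *)

(* Defs.v *)
From HB Require Import structures.
From mathcomp Require Import all_boot all_order all_algebra.
From mathcomp Require Import all_classical all_reals all_analysis.
From mathcomp Require Export mxtens.

Set Implicit Arguments.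
Unset Strict Implicit.
Unset Printing Implicit Defensive.

Import Order.TTheory GRing.Theory Num.Theory.
Import numFieldNormedType.Exports.

Local Open Scope classical_set_scope.
Local Open Scope ring_scope.

(* All indices are 0-based: modes are k : 'I_K and the coordinates of a tensor
   of shape (n_1, ..., n_K) in mode k are numbered by 'I_(n k). *)

Definition midx K (n : 'I_K -> nat) : finType :=
  {dffun forall k : 'I_K, 'I_(n k)}.

Definition tensor (R : Type) K (n : 'I_K -> nat) := midx n -> R.

Definition vec_pos K (n : 'I_K -> nat) (i : midx n) : nat :=
  (\sum_(k < K) i k * \prod_(l < K | k < l) n l)%N.

Lemma vec_pos_recl K (n : 'I_K.+1 -> nat) (i : midx n) :
  vec_pos i = (i ord0 * (\prod_(l < K) n (lift ord0 l)) +
    vec_pos (finfun (fun l : 'I_K => i (lift ord0 l)) :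
      midx (fun l => n (lift ord0 l))))%N.
Proof.
rewrite /vec_pos big_ord_recl; congr (_ * _ + _)%N.
  by rewrite big_mkcond big_ord_recl /= mul1n.
apply: eq_bigr => k _; rewrite ffunE; congr (_ * _)%N.
by rewrite big_mkcond big_ord_recl /= mul1n [RHS]big_mkcond.
Qed.

Lemma vec_pos_lt K (n : 'I_K -> nat) (i : midx n) :
  (vec_pos i < \prod_(k < K) n k)%N.
Proof.
elim: K n i => [|K IH] n i; first by rewrite /vec_pos !big_ord0.
rewrite vec_pos_recl big_ord_recl.
set j := finfun _; have {IH} := IH _ j; move: (vec_pos j) => p pP.
rewrite (leq_trans _ (leq_mul (ltn_ord (i ord0)) (leqnn _)))//.
by rewrite mulSn addnC ltn_add2r.
Qed.

Definition vec_index K (n : 'I_K -> nat) (i : midx n) : 'I_(\prod_(k < K) n k) :=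
  Ordinal (vec_pos_lt i).

Lemma vec_index_inj K (n : 'I_K -> nat) : injective (@vec_index K n).
Proof.
elim: K n => [|K IH] n i j.
  by move=> _; apply/ffunP => -[].
move=> /(congr1 val) /=; rewrite !vec_pos_recl.
set i' := finfun _; set j' := finfun _.
have := vec_pos_lt i'; have := vec_pos_lt j'.
move=> jP iP; have P0 := leq_ltn_trans (leq0n _) iP.
move=> e.
have e0 : i ord0 = j ord0.
  move: (congr1 (divn^~ (\prod_(k < K) n (lift ord0 k))) e) => /=.
  by rewrite !divnMDl// !divn_small// !addn0 => /val_inj.
have /IH/ffunP e' : vec_index i' = vec_index j'.
  by apply/val_inj/eqP; rewrite /= -(eqn_add2l
    (i ord0 * \prod_(k < K) n (lift ord0 k))) e e0.
apply/ffunP => k; case: (unliftP ord0 k) => [l ->|->//].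
by have := e' l; rewrite !ffunE.
Qed.

(* vec_index is a bijection, so the sum has exactly one term: see vecE. *)
Definition vec (R : nmodType) K (n : 'I_K -> nat) (M : tensor R n) :
    'rV[R]_(\prod_(k < K) n k) :=
  \row_p \sum_(i : midx n | vec_index i == p) M i.

Lemma vecE (R : nmodType) K (n : 'I_K -> nat) (M : tensor R n) (i : midx n) :
  vec M 0 (vec_index i) = M i.
Proof.
rewrite mxE (bigD1 i)//= big1 ?addr0// => j /andP[/eqP/vec_index_inj->].
by rewrite eqxx.
Qed.

Section modeproducts.
Variables (R : pzRingType) (K : nat).
Implicit Types n : 'I_K -> nat.

Definition mode_dims n (k : 'I_K) (m : nat) : 'I_K -> nat :=
  fun l => if l == k then m else n l.

Lemma mode_dims_eq n k m : mode_dims n k m k = m.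
Proof. by rewrite /mode_dims eqxx. Qed.

(* The sum over i_k is written as a sum over the multi-indices i that agree
   with j outside mode k. *)
Definition mode_prod n (W : tensor R n) (k : 'I_K) m (A : 'M[R]_(m, n k)) :
    tensor R (mode_dims n k m) :=
  fun j => \sum_(i : midx n | [forall l, (l != k) ==> (i l == j l :> nat)])
    W i * A (cast_ord (mode_dims_eq n k m) (j k)) (i k).

Definition rows_dims n (s : seq 'I_K) : 'I_K -> nat :=
  foldl (fun n k => mode_dims n k 1) n s.

Lemma rows_dims_mem n s k : rows_dims n s k = if k \in s then 1%N else n k.
Proof.
elim: s n => //= l s IH n; rewrite IH inE /mode_dims.
by case: eqP; case: (k \in s).
Qed.

Lemma rows_dims_enum n k : rows_dims n (enum 'I_K) k = 1%N.
Proof. by rewrite rows_dims_mem mem_enum. Qed.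

(* Successive products, in the order of s, of W with 1 x r matrices, r being
   the current size of the mode; a k r is the row used in mode k. *)
Fixpoint mode_prods (a : 'I_K -> forall r, 'rV[R]_r) (s : seq 'I_K) n :
    tensor R n -> tensor R (rows_dims n s) :=
  match s return tensor R n -> tensor R (rows_dims n s) with
  | [::] => fun W => W
  | k :: s' => fun W =>
      @mode_prods a s' (mode_dims n k 1) (mode_prod W (a k (n k)))
  end.
Global Arguments mode_prods a s [n] W.

(* W x_1 a_1 x_2 ... x_K a_K, the 1 x ... x 1 tensor being identified with its
   only entry. *)
Definition mode_prods_all (a : 'I_K -> forall r, 'rV[R]_r) n (W : tensor R n) :
    R :=
  mode_prods a (enum 'I_K) W
    (finfun (fun k => cast_ord (esym (rows_dims_enum n k)) ord0)).

End modeproducts.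

Lemma mode_prodsE (R : comPzRingType) K (f : 'I_K -> nat -> R) s n
    (W : tensor R n) (j : midx (rows_dims n s)) : uniq s ->
  mode_prods (fun k r => \row_(i < r) f k i) s W j =
  \sum_(i : midx n | [forall l, (l \notin s) ==> (i l == j l :> nat)])
    W i * \prod_(k <- s) f k (i k).
Proof.
elim: s n W j => [|k s IH] n W j /=.
  move=> _; rewrite (big_pred1 j) ?big_nil ?mulr1// => i /=.
  apply/forallP/eqP => [h|-> l]; last exact: eqxx.
  by apply/ffunP => l; apply/val_inj/eqP; exact: h l.
move=> /andP[ks us]; rewrite IH//.
have [lift1 lift1E] : exists f : midx n -> midx (mode_dims n k 1),
    forall i l, l != k -> f i l = i l :> nat.
  suff H (i : midx n) l : exists x : 'I_(mode_dims n k 1 l), l != k -> x = i l :> nat.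
    exists (fun i => finfun (fun l => sval (cid (H i l)))) => i l lk.
    by rewrite ffunE; case: cid => x /= ->.
  rewrite /mode_dims; case: eqP => [lk|lk]; first by exists ord0.
  by exists (i l).
have lift1k i (i' : midx (mode_dims n k 1)) : i' k = lift1 i k :> nat.
  have /(_ _ (mode_dims_eq n k 1)) H : forall m, m = 1%N -> forall x y : 'I_m, x = y :> nat.
    by move=> _ -> x y; rewrite !ord1.
  exact: H.
transitivity (\sum_(i' : midx (mode_dims n k 1) |
    [forall l, (l \notin s) ==> (i' l == j l :> nat)])
   \sum_(i : midx n | [forall l, (l != k) ==> (i l == i' l :> nat)])
     W i * f k (i k) * \prod_(k <- s) f k (i' k)).
  apply: eq_bigr => i' _; rewrite /mode_prod big_distrl /=.
  by apply: eq_bigr => i _; rewrite mxE.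
rewrite (exchange_big_dep (fun i : midx n =>
  [forall l, (l \notin k :: s) ==> (i l == j l :> nat)]))/=; last first.
  move=> i' i /forallP h1 /forallP h2; apply/forallP => l; apply/implyP.
  rewrite inE negb_or => /andP[lk ls].
  by rewrite (eqP (implyP (h2 l) lk)) (implyP (h1 l) ls).
apply: eq_bigr => i /forallP hi.
rewrite (big_pred1 (lift1 i)).
  rewrite big_cons -mulrA; congr (_ * (_ * _)).
  rewrite !big_seq; apply: eq_bigr => l ls; rewrite lift1E//.
  by apply: contraNneq ks => <-.
move=> i' /=; apply/andP/eqP => [[/forallP h1 /forallP h2]|->].
  apply/ffunP => l; apply: val_inj => /=.
  have [->|lk] := eqVneq l k; first exact: lift1k.
  by rewrite lift1E// -(eqP (implyP (h2 l) lk)).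
split; apply/forallP => l; apply/implyP => hl; last by rewrite lift1E.
have [->|lk] := eqVneq l k.
  rewrite -(lift1k i (lift1 i)).
  have e : rows_dims (mode_dims n k 1) s k = 1%N.
    by rewrite rows_dims_mem mode_dims_eq if_same.
  have H m p (em : m = 1%N) (ep : p = 1%N) (x : 'I_m) (y : 'I_p) : x = y :> nat.
    by move: x y; rewrite em ep => x y; rewrite !ord1.
  by apply/eqP/H => //; exact: mode_dims_eq.
rewrite lift1E//; apply: (implyP (hi l)).
by rewrite inE negb_or lk.
Qed.

Fixpoint kron (R : pzRingType) K :
    forall n : 'I_K -> nat, (forall k, 'M[R]_(n k)) -> 'M[R]_(\prod_(k < K) n k) :=
  match K with
  | 0 => fun n _ => 1%:M
  | K'.+1 => fun n A =>
      castmx (esym (big_ord_recl _ _), esym (big_ord_recl _ _))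
        (A ord0 *t kron (fun k => A (lift ord0 k)))
  end.

Lemma kronE (R : comPzRingType) K (n : 'I_K -> nat) (A : forall k, 'M[R]_(n k))
    (i j : midx n) :
  kron A (vec_index i) (vec_index j) = \prod_(k < K) A k (i k) (j k).
Proof.
elim: K n A i j => [|K IH] n A i j.
  rewrite [RHS]big_ord0 /= mxE (_ : _ == _)//; apply/eqP/val_inj.
  by rewrite /= /vec_pos; transitivity 0%N; rewrite big_ord0.
rewrite [RHS]big_ord_recl /= castmxE.
set i' := finfun (fun l : 'I_K => i (lift ord0 l)) :
  midx (fun l => n (lift ord0 l)).
set j' := finfun (fun l : 'I_K => j (lift ord0 l)) :
  midx (fun l => n (lift ord0 l)).
rewrite (_ : cast_ord _ (vec_index i) = mxtens_index (i ord0, vec_index i')); last first.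
  apply: val_inj => /=; exact: vec_pos_recl.
rewrite (_ : cast_ord _ (vec_index j) = mxtens_index (j ord0, vec_index j')); last first.
  apply: val_inj => /=; exact: vec_pos_recl.
rewrite tensmxE IH; congr (_ * _); apply: eq_bigr => k _.
by rewrite !ffunE.
Qed.

Section laws.
Variable R : realType.

Definition covmx N (S : 'M[R]_N) :=
  S^T = S /\ forall t : 'rV[R]_N, 0 <= (t *m S *m t^T) 0 0.

(* N(0, v) with variance v. The degenerate case is treated apart because the
   library's normal_prob m 0 is the uniform law on [0, 1]. *)
Definition normal_law (v : R) : set (measurableTypeR R) -> \bar R :=
  if v == 0 then \d_(0 : measurableTypeR R) else normal_prob 0 (Num.sqrt v).

(* X ~ N(0, S), possibly degenerate: every linear combination <t, X> of the
   coordinates has the univariate law N(0, t S t^T). *)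
Definition gaussian_vector d (T : measurableType d) (P : probability T R) N
    (X : T -> 'rV[R]_N) (S : 'M[R]_N) :=
  (forall i, measurable_fun [set: T] (fun w => X w 0 i)) /\
  forall (t : 'rV[R]_N) (A : set (measurableTypeR R)), measurable A ->
    pushforward P (fun w => (X w *m t^T) 0 0 : measurableTypeR R) A =
    normal_law ((t *m S *m t^T) 0 0) A.

Definition tensor_normal d (T : measurableType d) (P : probability T R)
    K (n : 'I_K -> nat) (M : T -> tensor R n) (Sigma : forall k, 'M[R]_(n k)) :=
  (forall k, covmx (Sigma k)) /\
  gaussian_vector P (fun w => vec (M w)) (kron Sigma).

Definition cvg_in_distribution (d : nat -> measure_display)
    (T : forall r, measurableType (d r)) (P : forall r, probability (T r) R)
    d' (T' : measurableType d') (P' : probability T' R) N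
    (X : forall r, T r -> 'rV[R]_N) (Y : T' -> 'rV[R]_N) :=
  forall h : 'rV[R]_N -> R, continuous h ->
    (exists C : R, forall x, `|h x| <= C) ->
    ('E_(P r)[fun w => h (X r w)] @[r --> \oo] -->
     'E_P'[fun w => h (Y w)])%E.

Section process.
Variables (K : nat) (E : 'I_K -> Type).

Definition eval_tensor (f : (forall k, E k) -> R) (n : 'I_K -> nat)
    (u : forall k, 'I_(n k) -> E k) : tensor R n :=
  fun j => f (fun k => u k (j k)).

Definition cov_matrix k (Sigma : E k -> E k -> R) n (u : 'I_n -> E k) :
    'M[R]_n :=
  \matrix_(i, j) Sigma (u i) (u j).

Definition tensor_gaussian_process d (T : measurableType d)
    (P : probability T R) (f : T -> (forall k, E k) -> R)
    (Sigma : forall k, E k -> E k -> R) :=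
  forall (n : 'I_K -> nat) (u : forall k, 'I_(n k) -> E k),
    tensor_normal P (fun w => eval_tensor (f w) u)
      (fun k => cov_matrix (Sigma k) (u k)).

(* The limit is a law: convergence is required towards every random tensor
   with law TN, on whatever probability space, and such a tensor is required
   to exist. *)
Definition cvg_to_tensor_gaussian_process (d : nat -> measure_display)
    (T : forall r, measurableType (d r)) (P : forall r, probability (T r) R)
    (f : forall r, T r -> (forall k, E k) -> R)
    (Sigma : forall k, E k -> E k -> R) :=
  forall (n : 'I_K -> nat) (u : forall k, 'I_(n k) -> E k),
    (exists d' (T' : measurableType d') (P' : probability T' R)
        (M : T' -> tensor R n),
        tensor_normal P' M (fun k => cov_matrix (Sigma k) (u k))) /\
    (forall d' (T' : measurableType d') (P' : probability T' R)
        (M : T' -> tensor R n),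
        tensor_normal P' M (fun k => cov_matrix (Sigma k) (u k)) ->
        cvg_in_distribution P P' (fun r w => vec (eval_tensor (f r w) u))
          (fun w => vec (M w))).

End process.

Definition ell2 (x : nat -> R) := cvgn (series (fun i => x i ^+ 2)).

Definition ell2_dot (x y : nat -> R) : R := limn (series (fun i => x i * y i)).

Section features.
Variables (K d : nat) (U : 'I_K -> set 'rV[R]_d) (phi : 'rV[R]_d -> nat -> R).

Definition feature (r : nat) (u : 'rV[R]_d) : 'rV[R]_r := \row_(i < r) phi u i.

Definition Sigma_trunc (r : nat) (k : 'I_K) (u v : U k) : R :=
  \sum_(i < r) feature r (set_val u) 0 i * feature r (set_val v) 0 i.

Definition Sigma_full (k : 'I_K) (u v : U k) : R :=
  ell2_dot (phi (set_val u)) (phi (set_val v)).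

Definition multilinear_fun (r : nat) (W : tensor R (fun _ : 'I_K => r))
    (u : forall k, U k) : R :=
  mode_prods_all (fun k m => feature m (set_val (u k))) W.

End features.
End laws.

Lemma multilinear_funE (R : realType) K d (U : 'I_K -> set 'rV[R]_d)
    (phi : 'rV[R]_d -> nat -> R) r 
    (W : tensor R (fun _ : 'I_K => r)) (u : forall k, U k) :
  multilinear_fun phi W u = \sum_i W i * \prod_(k < K) phi (set_val (u k)) (i k).
Proof.
rewrite /multilinear_fun /mode_prods_all.
rewrite (@mode_prodsE R K (fun k i => phi (set_val (u k)) i))//; last exact: enum_uniq.
apply: eq_big => [i|i _]; last by rewrite big_enum.
by apply/forallP => l; rewrite mem_enum.
Qed.

(* Main.v *)
(** On every finite grid the values of g^(r) form a linear image of vec W^(r),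
and the Kronecker product of the Gram matrices of phi^(r) is B^T B for the
matrix B of that linear map; this gives the exact law of g^(r).

The covariance matrices converge entrywise, by summability in l2.  Since the
law of a Gaussian vector enters only through its linear forms, the convergence
in distribution is a Cramer-Wold statement: convergence of E psi(<t, X_r>) for
all t and all bounded continuous psi of one variable implies that of E h(X_r)
for bounded continuous h.  It holds for h a trigonometric polynomial, a sum of
functions of linear forms; on a large box a general h is approximated uniformly
by trigonometric polynomials with the same bound, namely multivariate Bernstein
polynomials in the variables (1 + sin(x_i / L)) / 2; outside of the box, the
coordinates contribute little by tightness, itself a one-variable statement.

For one variable, a Gaussian of variance v has the law of sqrt v Z with Z a
standard one.  The scaling law of Z is read off the hypothesis on W^(1), so no
computation with normal densities is needed, and dominated convergence
concludes.  The limit law exists because a covariance matrix factors as A^T A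
(Cholesky) and W^(r) has enough independent standard coordinates for large r. *)

Require Import Defs.
From HB Require Import structures.
From mathcomp Require Import all_boot all_order all_algebra.
From mathcomp Require Import all_classical all_reals all_analysis.
From mathcomp Require Import measurable_realfun ring lra.

Set Implicit Arguments.
Unset Strict Implicit.
Unset Printing Implicit Defensive.

Import Order.TTheory GRing.Theory Num.Theory.
Import numFieldNormedType.Exports.

Local Open Scope classical_set_scope.
Local Open Scope ring_scope.

(** * Kronecker products and vectorization *)

Lemma mulmx_tr_delta (R : pzRingType) N (x : 'rV[R]_N) (i : 'I_N) :
  (x *m (delta_mx 0 i : 'rV[R]_N)^T) 0 0 = x 0 i.
Proof.
rewrite mxE (bigD1 i)//= !mxE !eqxx/= mulr1 big1 ?addr0// => j ji.
by rewrite !mxE (negbTE ji) andbF mulr0.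
Qed.

(** Injectivity suffices, since both sides have [\prod_k n k] elements. The inverse lets any row or
    column index be written [vec_index i], the form to which [kronE] and [vecE] apply. *)
Lemma vec_index_bij K (n : 'I_K -> nat) : bijective (@vec_index K n).
Proof.
apply: inj_card_bij; first exact: vec_index_inj.
rewrite card_ord card_dep_ffun /= -[X in (_ <= foldr _ _ X)%N]/(map _ _).
rewrite foldrE big_map big_enum /=.
by under [X in (_ <= X)%N]eq_bigr do rewrite card_ord.
Qed.

Lemma sum_vec_index (V : nmodType) K (n : 'I_K -> nat)
    (F : 'I_(\prod_(k < K) n k) -> V) :
  \sum_p F p = \sum_(i : midx n) F (vec_index i).
Proof. by apply: reindex; exact/onW_bij/vec_index_bij. Qed.

Lemma kron1 (R : comPzRingType) K (n : 'I_K -> nat) :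
  kron (fun k => 1%:M : 'M[R]_(n k)) = 1%:M.
Proof.
apply/matrixP => p q.
have [g _ gK] := vec_index_bij n; rewrite -(gK p) -(gK q) kronE.
rewrite mxE (inj_eq (@vec_index_inj _ _)).
have [->|ij] := eqVneq.
  by rewrite big1// => k _; rewrite mxE eqxx.
have [k ijk] : exists k, g p k != g q k.
  apply/existsP; apply: contra_neqT ij; rewrite negb_exists => /forallP h.
  by apply/ffunP => k; apply/eqP; rewrite -[_ == _]negbK; exact: h.
by rewrite (bigD1 k)//= mxE (negbTE ijk) mul0r.
Qed.

Lemma prod_sum_midx (R : comPzRingType) K r (F : 'I_K -> 'I_r -> R) :
  \prod_(k < K) \sum_(l < r) F k l =
  \sum_(i : midx (fun _ : 'I_K => r)) \prod_(k < K) F k (i k).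
Proof.
rewrite bigA_distr_bigA /=.
(* [bigA_distr_bigA] sums over plain finite functions, while [midx] consists of dependent ones; [h]
   only changes the type. *)
pose h (i : {ffun 'I_K -> 'I_r}) : midx (fun _ : 'I_K => r) :=
  [ffun k => i k].
rewrite [RHS](reindex h)/=; last first.
  exists (fun i => [ffun k => i k]) => i _; apply/ffunP => k; by rewrite !ffunE.
by apply: eq_bigr => i _; apply: eq_bigr => k _; rewrite ffunE.
Qed.

(** The mixed-product rule: [B] is the Kronecker product of the rectangular matrices
    [\matrix_(l, i) a k i l], given entrywise because [kron] takes square factors. The identity
    distributes a product of sums over [l]. *)
Lemma kron_gram (R : comPzRingType) K (n : 'I_K -> nat) r
    (a : forall k, 'I_(n k) -> 'I_r -> R) :
  exists2 B : 'M[R]_(\prod_(k < K) r, \prod_(k < K) n k),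
    forall (l : midx (fun _ : 'I_K => r)) (i : midx n),
      B (vec_index l) (vec_index i) = \prod_(k < K) a k (i k) (l k) &
    kron (fun k => \matrix_(i, j) \sum_(l < r) a k i l * a k j l) = B^T *m B.
Proof.
have [f fK Kf] := vec_index_bij n.
have [g gK _] := vec_index_bij (fun _ : 'I_K => r).
pose B : 'M[R]_(\prod_(k < K) r, \prod_(k < K) n k) :=
  \matrix_(p, q) \prod_(k < K) a k (f q k) (g p k).
have BE l i : B (vec_index l) (vec_index i) = \prod_(k < K) a k (i k) (l k).
  by rewrite mxE fK gK.
exists B => //; apply/matrixP => p q; rewrite -(Kf p) -(Kf q).
move: (f p) (f q) => i j; rewrite kronE mxE sum_vec_index.
rewrite (eq_bigr (fun k => \sum_(l < r) a k (i k) l * a k (j k) l)); last first.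
  by move=> k _; rewrite mxE.
rewrite (prod_sum_midx (fun k l => _)); apply: eq_bigr => l _.
by rewrite mxE !BE big_split.
Qed.

Lemma kron_cvg (R : realType) K (n : 'I_K -> nat)
    (A_ : nat -> forall k, 'M[R]_(n k)) (A : forall k, 'M[R]_(n k)) :
  (forall k i j, A_ r k i j @[r --> \oo] --> A k i j) ->
  forall p q, kron (A_ r) p q @[r --> \oo] --> kron A p q.
Proof.
move=> A_A p q; have [g _ gK] := vec_index_bij n.
rewrite -(gK p) -(gK q) kronE (funext (fun r => kronE (A_ r) _ _)).
apply: cvg_big; first exact: mul_continuous.
by move=> k _; exact: A_A.
Qed.

(** * Trigonometric approximation *)

(* The binomial weight 'C(m, k) y^k (1 - y)^(m - k), as the law at time m of a
   walk that steps up with probability y. *)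
Fixpoint bernstein_weight (R : pzRingType) (m k : nat) (y : R) : R :=
  match m with
  | 0 => (k == 0%N)%:R
  | m'.+1 => (if k is k'.+1 then y * bernstein_weight m' k' y else 0) +
             (1 - y) * bernstein_weight m' k y
  end.

Section bernstein_weight.
Variable R : realType.
Implicit Types (y : R) (m k : nat).

Lemma bernstein_weight_ge0 m k y : 0 <= y <= 1 -> 0 <= bernstein_weight m k y.
Proof.
move=> /andP[y0 y1]; elim: m k => [|m IH] k /=; first exact: ler0n.
rewrite addr_ge0// ?mulr_ge0 ?subr_ge0//.
by case: k => // k; rewrite mulr_ge0.
Qed.

Lemma bernstein_weight_gt m k y : (m < k)%N -> bernstein_weight m k y = 0.
Proof.
elim: m k => [|m IH] [|k]//= mk; rewrite !IH ?mulr0 ?addr0//.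
exact: ltnW.
Qed.

(** Conditioning on the last step of the walk; the total mass and the moments follow by induction on
    [m]. *)
Lemma sum_bernstein_weightS m y (f : nat -> R) :
  \sum_(k < m.+2) f k * bernstein_weight m.+1 k y =
  y * \sum_(k < m.+1) f k.+1 * bernstein_weight m k y +
  (1 - y) * \sum_(k < m.+1) f k * bernstein_weight m k y.
Proof.
under eq_bigr do rewrite /= mulrDr.
rewrite big_split/=; congr (_ + _).
  rewrite big_ord_recl/= mulr0 add0r mulr_sumr; apply: eq_bigr => k _.
  by rewrite mulrCA.
rewrite big_ord_recr/= bernstein_weight_gt// !mulr0 addr0 mulr_sumr.
by apply: eq_bigr => k _; rewrite mulrCA.
Qed.

Lemma sum_bernstein_weight m y :
  \sum_(k < m.+1) bernstein_weight m k y = 1.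
Proof.
elim: m => [|m IH]; first by rewrite big_ord1.
under eq_bigr do rewrite -[bernstein_weight _ _ _]mul1r.
rewrite (sum_bernstein_weightS m y (fun=> 1)).
by under eq_bigr do rewrite mul1r; rewrite IH; ring.
Qed.

Lemma bernstein_weight_variance m y :
  \sum_(k < m.+1) (k%:R - m%:R * y) ^+ 2 * bernstein_weight m k y =
  m%:R * (y * (1 - y)).
Proof.
(* The centred first moment is carried through the induction, because expanding the square after one
   more step leaves a term linear in [k%:R - m%:R * y]. *)
suff [] : \sum_(k < m.+1) (k%:R - m%:R * y) * bernstein_weight m k y = 0 /\
  \sum_(k < m.+1) (k%:R - m%:R * y) ^+ 2 * bernstein_weight m k y =
  m%:R * (y * (1 - y)) by [].
elim: m => [|m [IH1 IH2]].
  by rewrite !big_ord1/= !mul0r subr0 expr0n/= mul0r.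
have S0 := sum_bernstein_weight m y.
split.
  rewrite (sum_bernstein_weightS m y (fun k => k%:R - m.+1%:R * y)).
  (* Stepping up shifts the centred position by [1 - y], staying shifts it by [- y]. *)
  rewrite (eq_bigr (fun k : 'I_m.+1 => (k%:R - m%:R * y) *
    bernstein_weight m k y + (1 - y) * bernstein_weight m k y)); last first.
    by move=> k _; rewrite -!natr1; ring.
  rewrite [X in _ + _ * X](eq_bigr (fun k : 'I_m.+1 => (k%:R - m%:R * y) *
    bernstein_weight m k y + (- y) * bernstein_weight m k y)); last first.
    by move=> k _; rewrite -!natr1; ring.
  by rewrite !big_split/= -!mulr_sumr IH1 S0; ring.
rewrite (sum_bernstein_weightS m y (fun k => (k%:R - m.+1%:R * y) ^+ 2)).
rewrite (eq_bigr (fun k : 'I_m.+1 => (k%:R - m%:R * y) ^+ 2 *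
  bernstein_weight m k y + ((1 - y) *+ 2 * ((k%:R - m%:R * y) *
  bernstein_weight m k y) + (1 - y) ^+ 2 * bernstein_weight m k y)));
  last first.
  by move=> k _; rewrite -!natr1; ring.
rewrite [X in _ + _ * X](eq_bigr (fun k : 'I_m.+1 => (k%:R - m%:R * y) ^+ 2 *
  bernstein_weight m k y + ((- y *+ 2) * ((k%:R - m%:R * y) *
  bernstein_weight m k y) + y ^+ 2 * bernstein_weight m k y))); last first.
  by move=> k _; rewrite -!natr1; ring.
by rewrite !big_split/= -!mulr_sumr IH1 IH2 S0 -natr1; ring.
Qed.

(** The multivariate Bernstein polynomial: for [u] in the unit cube, the mean of [H] at the
    endpoints, divided by [m], of [N] independent walks with up-probabilities [u 0 i]. *)
Definition bernstein N m (H : 'rV[R]_N -> R) (u : 'rV[R]_N) : R :=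
  \sum_(k : {ffun 'I_N -> 'I_m.+1})
    H (\row_i ((k i)%:R / m%:R)) * \prod_i bernstein_weight m (k i) (u 0 i).

Lemma bernstein_weight_marginal N m (u : 'rV[R]_N) i (g : 'I_m.+1 -> R) :
  \sum_(k : {ffun 'I_N -> 'I_m.+1})
    g (k i) * \prod_j bernstein_weight m (k j) (u 0 j) =
  \sum_(l < m.+1) g l * bernstein_weight m l (u 0 i).
Proof.
(* [g (k i)] is absorbed into the weight of coordinate [i], so that the sum of products factorizes;
   the other factors are 1. *)
transitivity (\sum_(k : {ffun 'I_N -> 'I_m.+1})
    \prod_j (if j == i then g (k j) * bernstein_weight m (k j) (u 0 j)
             else bernstein_weight m (k j) (u 0 j))).
  apply: eq_bigr => k _; rewrite (bigD1 i)//= [RHS](bigD1 i)//= eqxx mulrA.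
  by congr (_ * _); apply: eq_bigr => j /negbTE ->.
rewrite -(bigA_distr_bigA (fun j (l : 'I_m.+1) =>
  if j == i then g l * bernstein_weight m l (u 0 j)
  else bernstein_weight m l (u 0 j)))/=.
rewrite (bigD1 i)//= eqxx [X in _ * X]big1 ?mulr1// => j /negbTE ->.
exact: sum_bernstein_weight.
Qed.

Lemma prod_bernstein_weight_sum N m (u : 'rV[R]_N) :
  \sum_(k : {ffun 'I_N -> 'I_m.+1})
    \prod_j bernstein_weight m (k j) (u 0 j) = 1.
Proof.
rewrite -(bigA_distr_bigA
  (fun j (l : 'I_m.+1) => bernstein_weight m l (u 0 j))).
by rewrite big1// => j _; exact: sum_bernstein_weight.
Qed.

Lemma prod_bernstein_weight_ge0 N m (u : 'rV[R]_N)
    (k : {ffun 'I_N -> 'I_m.+1}) : (forall i, 0 <= u 0 i <= 1) ->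
  0 <= \prod_j bernstein_weight m (k j) (u 0 j).
Proof. by move=> u01; apply: prodr_ge0 => i _; exact: bernstein_weight_ge0. Qed.

Lemma bernstein_bounded N m (H : 'rV[R]_N -> R) (C : R) (u : 'rV[R]_N) :
  (forall v, `|H v| <= C) -> (forall i, 0 <= u 0 i <= 1) ->
  `|bernstein m H u| <= C.
Proof.
move=> HC u01; rewrite (le_trans (ler_norm_sum _ _ _))//.
rewrite -[leRHS]mulr1 -[X in _ <= _ * X](prod_bernstein_weight_sum m u).
rewrite mulr_sumr ler_sum// => k _.
have k0 := prod_bernstein_weight_ge0 k u01.
by rewrite normrM (ger0_norm k0) ler_wpM2r.
Qed.

(* Chebyshev: the points k / m outside of the cube of radius del around u have
   total weight at most N / (del^2 m). *)
Lemma bernstein_error N m (H : 'rV[R]_N -> R) (C e del : R) (u : 'rV[R]_N) :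
  (0 < m)%N -> 0 <= e -> 0 < del -> (forall v, `|H v| <= C) ->
  (forall i, 0 <= u 0 i <= 1) ->
  (forall v : 'rV[R]_N, (forall i, 0 <= v 0 i <= 1) ->
    (forall i, `|u 0 i - v 0 i| < del) -> `|H u - H v| <= e) ->
  `|H u - bernstein m H u| <= e + C *+ 2 * N%:R / (del ^+ 2 * m%:R).
Proof.
move=> m0 e0 del0 HC u01 uc.
have C0 : 0 <= C by exact: le_trans (HC 0).
have m0' : 0 < m%:R :> R by rewrite ltr0n.
pose w (k : {ffun 'I_N -> 'I_m.+1}) := \prod_j bernstein_weight m (k j) (u 0 j).
have w0 (k : {ffun 'I_N -> 'I_m.+1}) : 0 <= w k.
  exact: prod_bernstein_weight_ge0.
have w1 : \sum_k w k = 1 by exact: prod_bernstein_weight_sum.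
pose dv (i : 'I_N) (l : 'I_m.+1) := ((l%:R - m%:R * u 0 i) / m%:R) ^+ 2.
have -> : H u - bernstein m H u =
    \sum_(k : {ffun 'I_N -> 'I_m.+1})
      (H u - H (\row_i ((k i)%:R / m%:R))) * w k.
  rewrite -[X in X - _ = _]mulr1 -[X in _ * X - _ = _]w1 mulr_sumr -sumrB.
  by apply: eq_bigr => k _; rewrite mulrBl.
(* Near [u] the difference is at most [e]. Elsewhere some [dv i (k i)] is at least [del ^+ 2], so
   the crude bound [C *+ 2] is below the second term. *)
apply: (@le_trans _ _
    (\sum_(k : {ffun 'I_N -> 'I_m.+1})
      (e + C *+ 2 / del ^+ 2 * \sum_i dv i (k i)) * w k)).
  rewrite (le_trans (ler_norm_sum _ _ _))// ler_sum// => k _.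
  rewrite normrM (ger0_norm (w0 k)) ler_wpM2r//.
  set v := \row_i _.
  have dv0 i : 0 <= dv i (k i) by exact: sqr_ge0.
  have [ltd|] := boolP [forall i, `|u 0 i - v 0 i| < del].
    rewrite (le_trans (uc v _ _))//.
    - move=> i; rewrite mxE divr_ge0//= ler_pdivrMr// mul1r ler_nat.
      by rewrite -ltnS ltn_ord.
    - by move=> i; exact: (forallP ltd).
    - by rewrite lerDl mulr_ge0 ?sumr_ge0// divr_ge0 ?mulrn_wge0// sqr_ge0.
  rewrite negb_forall => /existsP[i]; rewrite -leNgt => deli.
  rewrite (le_trans (ler_normB _ _))// (le_trans (lerD (HC _) (HC _)))//.
  rewrite -mulr2n ler_wpDl// -mulrA ler_peMr ?mulrn_wge0// mulrC.
  rewrite ler_pdivlMr ?exprn_gt0// mul1r (bigD1 i)//= ler_wpDr ?sumr_ge0//.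
  rewrite /dv (_ : _ / _ = - (u 0 i - v 0 i)); last first.
    by rewrite mxE; field; rewrite gt_eqF.
  by rewrite sqrrN -[leRHS]real_normK ?num_real// lerXn2r ?nnegrE// ltW.
under eq_bigr do rewrite mulrDl.
rewrite big_split/= -mulr_sumr w1 mulr1 lerD2l.
under eq_bigr do rewrite -mulrA mulr_suml.
rewrite -mulr_sumr exchange_big/=.
rewrite (_ : C *+ 2 * N%:R / _ = C *+ 2 / del ^+ 2 * (N%:R / m%:R)); last first.
  by field; rewrite !gt_eqF.
apply: ler_wpM2l; first by rewrite divr_ge0 ?mulrn_wge0// sqr_ge0.
rewrite -[leRHS]mulrC mulr_natr -[X in _ *+ X](card_ord N) -sumr_const.
apply: ler_sum => i _.
rewrite (bernstein_weight_marginal u i (dv i)).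
(* The variance [m y (1 - y)], divided by [m ^ 2], is at most [1 / m]. *)
under eq_bigr do rewrite /dv expr_div_n mulrAC.
rewrite -mulr_suml bernstein_weight_variance.
have /andP[ui0 ui1] := u01 i.
rewrite (_ : _ / _ = m%:R^-1 * (u 0 i * (1 - u 0 i))); last first.
  by field; rewrite gt_eqF.
rewrite ler_piMr ?invr_ge0 ?ler0n//.
by rewrite -[leRHS]mulr1 ler_pM ?subr_ge0// lerBlDr lerDl.
Qed.

End bernstein_weight.

(* Shifts c instead of separate sines keep the family of cosines closed under
   products, up to linear combinations. *)
Inductive trig_poly (R : realType) N : ('rV[R]_N -> R) -> Prop :=
| trig_cos (t : 'rV[R]_N) (c : R) :
    trig_poly (fun x => cos ((x *m t^T) 0 0 + c))
| trig_scale (a : R) f : trig_poly f -> trig_poly (fun x => a * f x)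
| trig_add f g : trig_poly f -> trig_poly g -> trig_poly (fun x => f x + g x).

Section trigonometric_polynomials.
Variables (R : realType) (N : nat).
Implicit Types (f g : 'rV[R]_N -> R) (t x : 'rV[R]_N).

Lemma trig_cst (c : R) : trig_poly (fun _ : 'rV[R]_N => c).
Proof.
have -> : (fun=> c) = (fun x : 'rV[R]_N =>
    c * cos ((x *m (0 : 'rV[R]_N)^T) 0 0 + 0)).
  by apply/funext => x; rewrite trmx0 mulmx0 mxE addr0 cos0 mulr1.
by apply: trig_scale; exact: trig_cos.
Qed.

Lemma trig_mul f g :
  trig_poly f -> trig_poly g -> trig_poly (fun x => f x * g x).
Proof.
move=> tf tg; elim: tf => {f} [t c|a f _ IH|f f' _ IHf _ IHf']; first last.
- have -> : (fun x => (f x + f' x) * g x) = (fun x => f x * g x + f' x * g x).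
    by apply/funext => x; rewrite mulrDl.
  exact: trig_add.
- have -> : (fun x => a * f x * g x) = (fun x => a * (f x * g x)).
    by apply/funext => x; rewrite mulrA.
  exact: trig_scale.
elim: tg => {g} [t' c'|a g _ IH|g g' _ IHg _ IHg']; first last.
- have -> : (fun x => cos ((x *m t^T) 0 0 + c) * (g x + g' x)) =
      (fun x => cos ((x *m t^T) 0 0 + c) * g x +
                cos ((x *m t^T) 0 0 + c) * g' x).
    by apply/funext => x; rewrite mulrDr.
  exact: trig_add.
- have -> : (fun x => cos ((x *m t^T) 0 0 + c) * (a * g x)) =
      (fun x => a * (cos ((x *m t^T) 0 0 + c) * g x)).
    by apply/funext => x; rewrite mulrCA.
  exact: trig_scale.
(* The product-to-sum formula for two cosines. *)
have -> : (fun x => cos ((x *m t^T) 0 0 + c) * cos ((x *m t'^T) 0 0 + c')) =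
    (fun x => 2^-1 * (cos ((x *m (t + t')^T) 0 0 + (c + c')) +
                      cos ((x *m (t - t')^T) 0 0 + (c - c')))).
  apply/funext => x; rewrite [(t + _)^T]raddfD [(t - _)^T]raddfB/=.
  rewrite mulmxDr mulmxBr !mxE.
  set a := \sum_i _; set b := \sum_i _.
  rewrite addrACA (_ : a - b + (c - c') = (a + c) - (b + c')); last by ring.
  by rewrite (cosD (a + c)) cosB; field.
by apply: trig_scale; apply: trig_add; exact: trig_cos.
Qed.

Lemma trig_sum (I : Type) (s : seq I) (F : I -> 'rV[R]_N -> R) :
  (forall i, trig_poly (F i)) -> trig_poly (fun x => \sum_(i <- s) F i x).
Proof.
move=> tF; elim: s => [|i s IH].
  rewrite (_ : (fun x => _) = fun=> 0); first exact: trig_cst.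
  by apply/funext => x; rewrite big_nil.
rewrite (_ : (fun x => _) = fun x => F i x + \sum_(j <- s) F j x).
  exact: trig_add.
by apply/funext => x; rewrite big_cons.
Qed.

Lemma trig_prod (I : Type) (s : seq I) (F : I -> 'rV[R]_N -> R) :
  (forall i, trig_poly (F i)) -> trig_poly (fun x => \prod_(i <- s) F i x).
Proof.
move=> tF; elim: s => [|i s IH].
  rewrite (_ : (fun x => _) = fun=> 1); first exact: trig_cst.
  by apply/funext => x; rewrite big_nil.
rewrite (_ : (fun x => _) = fun x => F i x * \prod_(j <- s) F j x).
  exact: trig_mul.
by apply/funext => x; rewrite big_cons.
Qed.

Lemma trig_sin_coord (i : 'I_N) (a : R) : trig_poly (fun x => sin (a * x 0 i)).
Proof.
have -> : (fun x => sin (a * x 0 i)) =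
    (fun x => cos ((x *m (a *: delta_mx 0 i : 'rV[R]_N)^T) 0 0 + - (pi / 2))).
  apply/funext => x; rewrite cosBpihalf; congr sin.
  by rewrite linearZ/= -scalemxAr mxE mulmx_tr_delta.
exact: trig_cos.
Qed.

Lemma trig_bounded f : trig_poly f -> exists C : R, forall x, `|f x| <= C.
Proof.
elim=> {f} [t c|a f _ [C fC]|f g _ [C fC] _ [D gD]].
- by exists 1 => x; exact: cos_max.
- by exists (`|a| * C) => x; rewrite normrM ler_wpM2l.
- by exists (C + D) => x; rewrite (le_trans (ler_normD _ _))// lerD.
Qed.

End trigonometric_polynomials.

Lemma trig_bernstein_weight (R : realType) N (g : 'rV[R]_N -> R) m k :
  trig_poly g -> trig_poly (fun x => bernstein_weight m k (g x)).
Proof.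
move=> tg; elim: m k => [|m IH] k /=; first exact: trig_cst.
apply: trig_add.
  by case: k => [|k]; [exact: trig_cst|exact: trig_mul].
apply: trig_mul => //; apply: trig_add; first exact: trig_cst.
rewrite (_ : (fun x => _) = (fun x => -1 * g x)); first exact: trig_scale.
by apply/funext => x; rewrite mulN1r.
Qed.

(** * Uniform approximation on a box *)

Lemma continuous_row (R : realType) (T : topologicalType) N
    (f : 'I_N -> T -> R) :
  (forall i, continuous (f i)) -> continuous (fun u => \row_i f i u : 'rV[R]_N).
Proof.
move=> cf u; apply/cvg_ballP => e e0; near=> v; split => // i j.
rewrite !mxE; move: j; near: v.
by apply: filter_forall => j; apply: (cvg_ball (cf j u)).
Unshelve. all: by end_near. Qed.

(** The radii given by continuity at each point become uniform by the near-covering form of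
    compactness, with [del] tending to 0 from the right. *)
Lemma rV_box_uniform_continuous (R : realType) N (H : 'rV[R]_N -> R) (e : R) :
  continuous H -> 0 < e ->
  exists2 del : R, 0 < del & forall u v : 'rV[R]_N,
    (forall i, 0 <= u 0 i <= 1) -> (forall i, `|u 0 i - v 0 i| < del) ->
    `|H u - H v| <= e.
Proof.
move=> cH e0.
have cK : compact [set u : 'rV[R]_N | forall i, `[0, 1]%classic (u ord0 i)].
  apply: (@rV_compact R N (fun=> `[0, 1]%classic)) => i.
  exact: segment_compact.
have /(_ R 0^'+ (fun del u => forall v : 'rV[R]_N,
    (forall i, `|u 0 i - v 0 i| < del) -> `|H u - H v| <= e) _) []//:=
  (compact_near_coveringP _).1 cK.
- move=> x _.
  have /cvgrPdist_lt/(_ (e / 2)) := cH x.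
  rewrite divr_gt0// => /(_ isT)/nbhs_ballP[d /= d0 dH].
  (* Half the radius is spent from [x] to [u] and half from [u] to [v]. *)
  have d20 : 0 < d / 2 by rewrite divr_gt0.
  exists (ball x (d / 2), [set del | del < d / 2]); first split => /=.
  + exact: nbhsx_ballx.
  + exact: nbhs_right_lt.
  move=> [u del] /= [[_ xu] deld] v uv.
  have Hu : `|H x - H u| < e / 2.
    apply: dH; split => // i j; apply: (le_ball _ (xu i j)).
    by move: d0 => /= d0; lra.
  have Hv : `|H x - H v| < e / 2.
    apply: dH; split => // i j; rewrite (splitr d).
    apply: (ball_triangle (xu i j)); rewrite ord1.
    exact: lt_trans (uv j) deld.
  rewrite (_ : H u - H v = (H x - H v) - (H x - H u)); last by ring.
  rewrite (le_trans (ler_normB _ _))// [leRHS](splitr e).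
  by rewrite lerD// ltW.
- move=> del /= del0 near_del.
  exists (del / 2); first by rewrite divr_gt0.
  move=> u v u01 uv; apply: (near_del (del / 2)) => //=.
  + rewrite sub0r normrN gtr0_norm ?divr_gt0//.
    by rewrite ltr_pdivrMr// ltr_pMr// ltr1n.
  + by rewrite divr_gt0.
Qed.

Lemma continuous_clip_asin (R : realType) (s : R) : 0 <= s < 1 ->
  continuous (fun y : R => asin (Num.max (- s) (Num.min s (y *+ 2 - 1)))).
Proof.
move=> /andP[s0 s1] y; apply: continuous_comp.
  apply: continuous_max; first exact: cvg_cst.
  apply: continuous_min; first exact: cvg_cst.
  by apply: cvgB; [apply: cvgMn; exact: cvg_id|exact: cvg_cst].
apply: continuous_asin; apply/andP; split.
  by rewrite lt_max ltrN2 s1.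
rewrite gt_max (le_lt_trans _ s1) ?gt_min ?s1//= lerNl.
by rewrite (le_trans _ s0)// oppr_le0.
Qed.

(** A Bernstein polynomial of [H] is composed with the map [u], where [h x = H (u x)] on the box. As
    [u] sends every [x] into the unit cube, the bound [C] holds on the whole space. *)
Lemma trig_approx (R : realType) N (h : 'rV[R]_N -> R) (C M e : R) :
  continuous h -> (forall x, `|h x| <= C) -> 0 < M -> 0 < e ->
  exists T, [/\ trig_poly T, forall x, `|T x| <= C &
    forall x : 'rV[R]_N, (forall i, `|x 0 i| <= M) -> `|h x - T x| <= e].
Proof.
move=> ch hC M0 e0.
have C0 : 0 <= C by exact: le_trans (hC 0).
pose s : R := sin (2^-1).
(* This scale keeps [x 0 i / L] within [1 / 2] of 0, where the sine is invertible and bounded by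
   [s < 1]. *)
pose L := M *+ 2.
have L0 : 0 < L by rewrite mulrn_wgt0.
have half_pihalf : (2^-1 : R) < pi / 2.
  by rewrite (lt_le_trans _ (pihalf_ge1 R))// invf_lt1// ltr1n.
have s0 : 0 <= s.
  by rewrite ltW// sin_gt0_pihalf// invr_gt0 ltr0n.
have itvP (a : R) : `|a| <= 2^-1 -> a \in `[(- (pi / 2)), pi / 2].
  move=> a2; rewrite in_itv/= -ler_norml; exact/ltW/(le_lt_trans a2).
have norm_half : `|2^-1| = 2^-1 :> R by rewrite ger0_norm.
have s1 : s < 1.
  rewrite -(@sin_pihalf R) ltr_sin//.
    by apply: itvP; rewrite norm_half.
  by rewrite in_itv/= lexx andbT ge0_cp// ltW// (lt_trans _ half_pihalf).
(* G inverts x |-> (1 + sin (x / L)) / 2 on [-M, M]; the clipping keeps asin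
   away from the end points, where continuous_asin does not apply. *)
pose G (y : R) := L * asin (Num.max (- s) (Num.min s (y *+ 2 - 1))).
have cG : continuous G.
  move=> y; apply: cvgM; first exact: cvg_cst.
  by apply: continuous_clip_asin; rewrite s0.
pose H (u : 'rV[R]_N) := h (\row_i G (u 0 i)).
have cH : continuous H.
  move=> u; apply: (@continuous_comp _ _ _
    (fun u : 'rV[R]_N => \row_i G (u 0 i)) h); last exact: ch.
  apply: (@continuous_row R _ N (fun i (u : 'rV[R]_N) => G (u 0 i))) => i {}u.
  apply: (@continuous_comp _ _ _ (fun u : 'rV[R]_N => u 0 i) G); last exact: cG.
  exact: coord_continuous.
have HC u : `|H u| <= C by exact: hC.
have e20 : 0 < e / 2 by rewrite divr_gt0.
have [del del0 ucH] := rV_box_uniform_continuous cH e20.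
(* [A < m] makes the Chebyshev term of [bernstein_error] at most [e / 2]. *)
pose A := C *+ 2 * N%:R / del ^+ 2 / (e / 2).
have A0 : 0 <= A by rewrite !divr_ge0 ?mulr_ge0 ?mulrn_wge0 ?sqr_ge0// ltW.
pose m := (Num.truncn A).+1.
have Am : A < m%:R by exact: truncnS_gt.
have m0 : 0 < m%:R :> R by rewrite ltr0n.
pose u (x : 'rV[R]_N) : 'rV[R]_N := \row_i ((1 + sin (L^-1 * x 0 i)) / 2).
have u01 x i : 0 <= u x 0 i <= 1.
  have := sin_geN1 (L^-1 * x 0 i); have := sin_le1 (L^-1 * x 0 i).
  by rewrite mxE => *; apply/andP; split; lra.
exists (fun x => bernstein m H (u x)); split.
- apply: trig_sum => k; apply: trig_scale; apply: trig_prod => i.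
  apply: trig_bernstein_weight.
  rewrite (_ : (fun x => u x 0 i) =
      (fun x => 2^-1 * (1 + sin (L^-1 * x 0 i)))); last first.
    by apply/funext => x; rewrite mxE mulrC.
  apply: trig_scale; apply: trig_add; first exact: trig_cst.
  exact: trig_sin_coord.
- by move=> x; exact: bernstein_bounded.
move=> x xM.
have -> : h x = H (u x).
  rewrite /H; congr h; apply/rowP => i; rewrite !mxE /G.
  have xL : `|L^-1 * x 0 i| <= 2^-1.
    rewrite normrM gtr0_norm ?invr_gt0// mulrC ler_pdivrMr//.
    by have := xM i; rewrite /L => ?; lra.
  have /ler_normlP[sN sP] : `|sin (L^-1 * x 0 i)| <= s.
    move: (xL); rewrite !ler_norml => /andP[xL1 xL2]; apply/andP; split.
      rewrite -sinN leNgt ltr_sin -?leNgt//; apply: itvP => //.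
      by rewrite normrN norm_half.
    by rewrite leNgt ltr_sin -?leNgt//; apply: itvP => //; rewrite norm_half.
  rewrite (_ : _ *+ 2 - 1 = sin (L^-1 * x 0 i)); last first.
    by rewrite -mulr_natr; field.
  rewrite min_r// max_r; last by rewrite lerNl.
  by rewrite sinK ?itvP// mulrA divff ?mul1r// gt_eqF.
rewrite [leRHS](splitr e).
rewrite (le_trans (@bernstein_error R N m H C (e / 2) del (u x) _ _ _ _ _ _))//.
- exact: ltW.
- by move=> v v01; apply: ucH.
rewrite lerD2l invfM mulrA ler_pdivrMr// -ler_pdivrMl// [leLHS]mulrC.
exact: ltW.
Qed.

(** * The Cramer-Wold device *)

Section bounded_random_variables.
Variables (R : realType) (d : measure_display) (T : measurableType d).
Variable P : probability T R.
Implicit Types (X Y : T -> R) (C : R).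

Definition bounded_rv X :=
  measurable_fun [set: T] X /\ exists C, forall w, `|X w| <= C.

Lemma bounded_rv_integrable X :
  bounded_rv X -> P.-integrable [set: T] (EFin \o X).
Proof.
move=> [mX [C XC]]; apply: measurable_bounded_integrable => //.
  by rewrite (le_lt_trans (probability_le1 _ _))// ltry.
exists C; split; first exact: num_real.
by move=> M CM w _ /=; rewrite (le_trans (XC w))// ltW.
Qed.

Lemma bounded_rv_expectation X :
  bounded_rv X -> 'E_P[X]%E = (\int[P]_w X w)%:E.
Proof.
move=> bX; rewrite unlock /Rintegral fineK//.
exact/integrable_fin_num/bounded_rv_integrable.
Qed.

Lemma bounded_rv_cst C : bounded_rv (fun=> C).
Proof. by split; [exact: measurable_cst|exists `|C|]. Qed.

Lemma bounded_rv_add X Y :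
  bounded_rv X -> bounded_rv Y -> bounded_rv (fun w => X w + Y w).
Proof.
move=> [mX [C XC]] [mY [D YD]]; split; first exact: measurable_funD.
by exists (C + D) => w; rewrite (le_trans (ler_normD _ _))// lerD.
Qed.

Lemma bounded_rv_scale a X : bounded_rv X -> bounded_rv (fun w => a * X w).
Proof.
move=> [mX [C XC]]; split.
  by apply: measurable_funM => //; exact: measurable_cst.
by exists (`|a| * C) => w; rewrite normrM ler_wpM2l.
Qed.

Lemma bounded_rv_sum (I : Type) (s : seq I) (X : I -> T -> R) :
  (forall i, bounded_rv (X i)) -> bounded_rv (fun w => \sum_(i <- s) X i w).
Proof.
move=> bX; elim: s => [|i s IH].
  by under eq_fun do rewrite big_nil; exact: bounded_rv_cst.
by under eq_fun do rewrite big_cons; exact: bounded_rv_add.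
Qed.

Lemma Rintegral_sum (I : Type) (s : seq I) (X : I -> T -> R) :
  (forall i, bounded_rv (X i)) ->
  \int[P]_w (\sum_(i <- s) X i w) = \sum_(i <- s) \int[P]_w X i w.
Proof.
move=> bX; elim: s => [|i s IH].
  under eq_Rintegral do rewrite big_nil.
  by rewrite big_nil Rintegral_cst// mul0r.
under eq_Rintegral do rewrite big_cons.
rewrite RintegralD//; last 2 first.
- exact: bounded_rv_integrable.
- by apply: bounded_rv_integrable; exact: bounded_rv_sum.
by rewrite big_cons IH.
Qed.

Lemma Rintegral_dist_le X Y (Z : T -> R) : bounded_rv X -> bounded_rv Y ->
  bounded_rv Z -> (forall w, `|X w - Y w| <= Z w) ->
  `|\int[P]_w X w - \int[P]_w Y w| <= \int[P]_w Z w.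
Proof.
move=> bX bY bZ XYZ.
have bXY : bounded_rv (fun w => X w - Y w).
  under eq_fun do rewrite -mulN1r.
  by apply: bounded_rv_add => //; exact: bounded_rv_scale.
rewrite -RintegralB//; [|exact: bounded_rv_integrable..].
rewrite (le_trans (le_normr_Rintegral _ _))//.
  exact: bounded_rv_integrable.
apply: le_Rintegral => //; last exact: bounded_rv_integrable.
apply: bounded_rv_integrable; have [mXY [C XYC]] := bXY.
by split; [exact: measurableT_comp|exists C => w; rewrite normr_id].
Qed.

(** Dominated convergence with the constant [C] as majorant; the limit inherits measurability and
    the bound. *)
Lemma bounded_cvg_Rintegral (X_ : nat -> T -> R) X C :
  (forall n, measurable_fun [set: T] (X_ n)) ->
  (forall n w, `|X_ n w| <= C) -> (forall w, X_ n w @[n --> \oo] --> X w) ->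
  \int[P]_w X_ n w @[n --> \oo] --> \int[P]_w X w.
Proof.
move=> mX_ X_C X_X.
have mX : measurable_fun [set: T] X by apply: (measurable_fun_cvg mX_) => w _.
have XC w : `|X w| <= C.
  have cn : `|X_ n w| @[n --> \oo] --> `|X w| by apply: cvg_norm; exact: X_X.
  rewrite -(cvg_lim _ cn)//; apply: limr_le.
    by apply/cvg_ex; exists `|X w|.
  exact: nearW.
have bX : bounded_rv X by split => //; exists C.
have iC := bounded_rv_integrable (bounded_rv_cst C).
apply: fine_cvg; rewrite fineK; last first.
  exact/integrable_fin_num/bounded_rv_integrable.
have m_ n : measurable_fun [set: T] (fun w => (X_ n w)%:E).
  exact/measurable_EFinP.
have m : measurable_fun [set: T] (fun w => (X w)%:E) by exact/measurable_EFinP.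
have cv : {ae P, forall w, [set: T] w ->
    (X_ n w)%:E @[n --> \oo] --> (X w)%:E}.
  by apply: aeW => w _; apply: cvg_EFin; [exact: nearW|exact: X_X].
have dom : {ae P, forall w n, [set: T] w -> (`|(X_ n w)%:E| <= C%:E)%E}.
  by apply: aeW => w n _; rewrite lee_fin.
by have [_ _] := dominated_convergence measurableT m_ m cv iC dom.
Qed.

End bounded_random_variables.

Lemma bounded_rv_comp (R : realType) d (T : measurableType d) (X : T -> R)
    (psi : R -> R) : measurable_fun [set: T] X -> continuous psi ->
  (exists C : R, forall x, `|psi x| <= C) -> bounded_rv (fun w => psi (X w)).
Proof.
move=> mX cpsi [C psiC]; split; last by exists C.
by apply: measurableT_comp => //; exact: continuous_measurable_fun.
Qed.

Lemma eq_law_Rintegral (R : realType) d1 d2 (T1 : measurableType d1)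
    (T2 : measurableType d2) (P1 : probability T1 R) (P2 : probability T2 R)
    (X1 : T1 -> R) (X2 : T2 -> R) (psi : R -> R) :
  measurable_fun [set: T1] X1 -> measurable_fun [set: T2] X2 ->
  (forall A : set (measurableTypeR R), measurable A ->
    pushforward P1 (X1 : T1 -> measurableTypeR R) A =
    pushforward P2 (X2 : T2 -> measurableTypeR R) A) ->
  continuous psi -> (exists C : R, forall x, `|psi x| <= C) ->
  \int[P1]_w psi (X1 w) = \int[P2]_w psi (X2 w).
Proof.
move=> mX1 mX2 eq12 cpsi bpsi.
have mpsi : measurable_fun [set: R] (EFin \o psi).
  by apply/measurable_EFinP; exact: continuous_measurable_fun.
have i1 := bounded_rv_integrable P1 (bounded_rv_comp mX1 cpsi bpsi).
have i2 := bounded_rv_integrable P2 (bounded_rv_comp mX2 cpsi bpsi).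
congr fine.
have := @integral_pushforward _ _ _ _ _ _ mX1 P1 setT _ mpsi i1 measurableT.
have := @integral_pushforward _ _ _ _ _ _ mX2 P2 setT _ mpsi i2 measurableT.
rewrite !preimage_setT => <- <-.
by apply: eq_measure_integral => A mA _; exact: eq12.
Qed.

Section random_vectors.
Variables (R : realType) (N : nat).

Definition random_vector d (T : measurableType d) (X : T -> 'rV[R]_N) :=
  forall i, measurable_fun [set: T] (fun w => X w 0 i).

Lemma measurable_linear_form d (T : measurableType d) (X : T -> 'rV[R]_N)
    (t : 'rV[R]_N) :
  random_vector X -> measurable_fun [set: T] (fun w => (X w *m t^T) 0 0).
Proof.
move=> mX; under eq_fun do rewrite mxE.
by apply: measurable_sum => i; exact: measurable_funM.
Qed.

Lemma measurable_trig d (T : measurableType d) (X : T -> 'rV[R]_N) f :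
  random_vector X -> trig_poly f -> measurable_fun [set: T] (fun w => f (X w)).
Proof.
move=> mX; elim=> {f} [t c|a f _ mf|f g _ mf _ mg].
- apply: (measurableT_comp (continuous_measurable_fun (@continuous_cos R))).
  apply: measurable_funD; first exact: measurable_linear_form.
  exact: measurable_cst.
- by apply: measurable_funM => //; exact: measurable_cst.
- exact: measurable_funD.
Qed.

Lemma bounded_rv_trig d (T : measurableType d) (X : T -> 'rV[R]_N) f :
  random_vector X -> trig_poly f -> bounded_rv (fun w => f (X w)).
Proof.
move=> mX tf; split; first exact: measurable_trig.
by have [C fC] := trig_bounded tf; exists C.
Qed.

(** Measurability comes from the coordinates alone: [h] is the pointwise limit of trigonometric
    polynomials, the [n]-th one within [1 / (n + 1)] of [h] on the box of half-width [n + 1]. *)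
Lemma bounded_rv_continuous d (T : measurableType d) (X : T -> 'rV[R]_N)
    (h : 'rV[R]_N -> R) :
  random_vector X -> continuous h -> (exists C : R, forall x, `|h x| <= C) ->
  bounded_rv (fun w => h (X w)).
Proof.
move=> mX ch [C hC]; split; last by exists C.
have n0 n : 0 < n.+1%:R :> R by rewrite ltr0n.
have invn0 n : 0 < n.+1%:R^-1 :> R by rewrite invr_gt0.
have /choice[f fP] n := trig_approx ch hC (n0 n) (invn0 n).
apply: (@measurable_fun_cvg _ _ _ _ (fun n w => f n (X w))).
  by move=> n; apply: measurable_trig => //; have [] := fP n.
move=> w _; apply/cvgrPdist_le => e e0; near=> n.
have [_ _ fn] := fP n.
rewrite (le_trans (fn _ _))//.
  near: n; apply: filter_forall => i; near=> n.
  by rewrite (@le_trans _ _ n%:R) ?ler_nat//; near: n; exact: nbhs_infty_ger.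
near: n; have := near_infty_natSinv_lt (PosNum e0).
by apply: filterS => n /ltW.
Unshelve. all: by end_near. Qed.

(** A continuous substitute for the indicator of a tail: 0 up to [M], 1 from [M + 1] on. Continuity
    puts its integrals within reach of [cvg_proj]. *)
Definition tail_cutoff (M x : R) : R := Num.min 1 (Num.max 0 (`|x| - M)).

Lemma tail_cutoff_continuous M : continuous (tail_cutoff M).
Proof.
move=> x.
apply: (@continuous_min _ _ (fun=> 1) (fun x => Num.max 0 (`|x| - M))).
  exact: cvg_cst.
apply: (@continuous_max _ _ (fun=> 0) (fun x => `|x| - M)).
  exact: cvg_cst.
by apply: cvgB; [apply: cvg_norm; exact: cvg_id|exact: cvg_cst].
Qed.

Lemma tail_cutoff_ge0 M x : 0 <= tail_cutoff M x.
Proof. by rewrite /tail_cutoff le_min ler01/= le_max lexx. Qed.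

Lemma tail_cutoff_le1 M x : tail_cutoff M x <= 1.
Proof. by rewrite /tail_cutoff ge_min lexx. Qed.

Lemma tail_cutoff_norm M x : `|tail_cutoff M x| <= 1.
Proof. by rewrite ger0_norm ?tail_cutoff_ge0 ?tail_cutoff_le1. Qed.

Lemma tail_cutoff1 M x : M + 1 <= `|x| -> tail_cutoff M x = 1.
Proof.
by move=> Mx; rewrite /tail_cutoff min_l// le_max lerBrDl Mx orbT.
Qed.

Lemma tail_cutoff0 M x : `|x| <= M -> tail_cutoff M x = 0.
Proof.
by move=> Mx; rewrite /tail_cutoff max_l ?subr_le0// min_r.
Qed.

(** Outside the box of half-width [n + 1] some cutoff has reached 1, and there [C *+ 2] bounds the
    difference of two functions bounded by [C]. *)
Lemma trig_approx_cutoff (h : 'rV[R]_N -> R) (C e : R) (n : nat) :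
  continuous h -> (forall x, `|h x| <= C) -> 0 < e ->
  exists2 T, trig_poly T & forall x : 'rV[R]_N,
    `|h x - T x| <= e + C *+ 2 * \sum_i tail_cutoff n%:R (x 0 i).
Proof.
move=> ch hC e0.
have C0 : 0 <= C by exact: le_trans (hC 0).
have n0 : 0 < n.+1%:R :> R by rewrite ltr0n.
have [T [tT TC hT]] := trig_approx ch hC n0 e0.
exists T => // x.
have s0 : 0 <= \sum_i tail_cutoff n%:R (x 0 i).
  by apply: sumr_ge0 => i _; exact: tail_cutoff_ge0.
have [xn|] := boolP [forall i, `|x 0 i| <= n.+1%:R].
  rewrite (le_trans (hT x _))//; first by move=> i; exact: (forallP xn).
  by rewrite lerDl mulr_ge0// mulrn_wge0.
rewrite negb_forall => /existsP[i]; rewrite -ltNge => xi.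
rewrite (le_trans (ler_normB _ _))// (le_trans (lerD (hC _) (TC _)))//.
rewrite -mulr2n ler_wpDl ?(ltW e0)// ler_peMr ?mulrn_wge0//.
rewrite (bigD1 i)//= tail_cutoff1 ?natr1 ?(ltW xi)// lerDl.
by apply: sumr_ge0 => j _; exact: tail_cutoff_ge0.
Qed.

Section cramer_wold.
Unset Implicit Arguments.
Variables (d : nat -> measure_display) (T : forall r, measurableType (d r)).
Variables (P : forall r, probability (T r) R).
Variables (d' : measure_display) (T' : measurableType d').
Variables (P' : probability T' R).
Variables (X : forall r, T r -> 'rV[R]_N) (Y : T' -> 'rV[R]_N).
Hypotheses (mX : forall r, random_vector (X r)) (mY : random_vector Y).
Hypothesis cvg_proj : forall (t : 'rV[R]_N) (psi : R -> R), continuous psi ->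
  (exists C : R, forall x, `|psi x| <= C) ->
  \int[P r]_w psi ((X r w *m t^T) 0 0) @[r --> \oo] -->
  \int[P']_w psi ((Y w *m t^T) 0 0).
Set Implicit Arguments.

(** A cosine with a phase is a bounded continuous function of one linear form, hence covered by
    [cvg_proj]; linearity of the integral does the rest. *)
Let cvg_trig f : trig_poly f ->
  \int[P r]_w f (X r w) @[r --> \oo] --> \int[P']_w f (Y w).
Proof.
elim=> {f} [t c|a f tf IH|f g tf IHf tg IHg].
- apply: (@cvg_proj t (fun x => cos (x + c))).
    move=> x; apply: continuous_comp; last exact: continuous_cos.
    by apply: cvgD; [exact: cvg_id|exact: cvg_cst].
  by exists 1 => x; exact: cos_max.
- have E d1 (T1 : measurableType d1) (P1 : probability T1 R)
      (Z : T1 -> 'rV[R]_N) : random_vector Z ->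
      \int[P1]_w (a * f (Z w)) = a * \int[P1]_w f (Z w).
    move=> mZ; rewrite RintegralZl//.
    exact/bounded_rv_integrable/bounded_rv_trig.
  rewrite (funext (fun r => E _ _ (P r) _ (mX r))) (E _ _ P' _ mY).
  by apply: cvgM; [exact: cvg_cst|exact: IH].
- have E d1 (T1 : measurableType d1) (P1 : probability T1 R)
      (Z : T1 -> 'rV[R]_N) : random_vector Z ->
      \int[P1]_w (f (Z w) + g (Z w)) = \int[P1]_w f (Z w) + \int[P1]_w g (Z w).
    move=> mZ; rewrite RintegralD//.
      exact/bounded_rv_integrable/bounded_rv_trig.
    exact/bounded_rv_integrable/bounded_rv_trig.
  rewrite (funext (fun r => E _ _ (P r) _ (mX r))) (E _ _ P' _ mY).
  by apply: cvgD; [exact: IHf|exact: IHg].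
Qed.

Let bounded_rv_cutoff d1 (T1 : measurableType d1) (Z : T1 -> 'rV[R]_N) n i :
  random_vector Z -> bounded_rv (fun w => tail_cutoff n%:R (Z w 0 i)).
Proof.
move=> mZ; apply: bounded_rv_comp => //; first exact: tail_cutoff_continuous.
by exists 1 => x; exact: tail_cutoff_norm.
Qed.

Let cvg_cutoff n :
  \int[P r]_w (\sum_i tail_cutoff n%:R (X r w 0 i)) @[r --> \oo] -->
  \int[P']_w (\sum_i tail_cutoff n%:R (Y w 0 i)).
Proof.
have E i : \int[P r]_w tail_cutoff n%:R (X r w 0 i) @[r --> \oo] -->
    \int[P']_w tail_cutoff n%:R (Y w 0 i).
  have := @cvg_proj (delta_mx 0 i) _ (@tail_cutoff_continuous n%:R)
    (ex_intro _ 1 (@tail_cutoff_norm n%:R)).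
  under eq_fun do under eq_Rintegral do rewrite mulmx_tr_delta.
  by under eq_Rintegral do rewrite mulmx_tr_delta.
rewrite Rintegral_sum//=; last by move=> i; exact: bounded_rv_cutoff.
rewrite (_ : (fun r => _) =
    (fun r => \sum_i \int[P r]_w tail_cutoff n%:R (X r w 0 i))); last first.
  by apply/funext => r; rewrite Rintegral_sum// => i; exact: bounded_rv_cutoff.
apply: cvg_big; first exact: add_continuous.
by move=> i _; exact: E.
Qed.

(** Tightness of [Y]: at each [w] all cutoffs vanish for large [n], and their sum never exceeds
    [N]. *)
Let cvg_cutoff0 :
  \int[P']_w (\sum_i tail_cutoff n%:R (Y w 0 i)) @[n --> \oo] --> (0 : R).
Proof.
suff : \int[P']_w (\sum_i tail_cutoff n%:R (Y w 0 i)) @[n --> \oo] -->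
    \int[P']_w (cst 0 w : R) by rewrite Rintegral_cst// mul0r.
apply: (@bounded_cvg_Rintegral _ _ _ _ _ _ N%:R).
- move=> n.
  by have [] := bounded_rv_sum (index_enum _)
    (fun i => @bounded_rv_cutoff _ _ Y n i mY).
- move=> n w; rewrite (le_trans (ler_norm_sum _ _ _))//.
  rewrite -[X in _ <= X%:R](card_ord N) -sumr_const ler_sum// => i _.
  exact: tail_cutoff_norm.
move=> w; apply: (@cvg_near_cst _ R^o); near=> n; apply: big1 => i _.
apply: tail_cutoff0; move: i; near: n; apply: filter_forall => i.
exact: nbhs_infty_ger.
Unshelve. all: by end_near. Qed.

Let Rintegral_trig_error d1 (T1 : measurableType d1) (P1 : probability T1 R)
    (Z : T1 -> 'rV[R]_N) (h f : 'rV[R]_N -> R) (C e : R) n :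
  random_vector Z -> continuous h -> (exists C : R, forall x, `|h x| <= C) ->
  trig_poly f -> (forall x : 'rV[R]_N,
    `|h x - f x| <= e + C *+ 2 * \sum_i tail_cutoff n%:R (x 0 i)) ->
  `|\int[P1]_w h (Z w) - \int[P1]_w f (Z w)| <=
  e + C *+ 2 * \int[P1]_w (\sum_i tail_cutoff n%:R (Z w 0 i)).
Proof.
move=> mZ ch bh tf hf.
have bs : bounded_rv (fun w => \sum_i tail_cutoff n%:R (Z w 0 i)).
  by apply: bounded_rv_sum => i; exact: bounded_rv_cutoff.
have b2 : bounded_rv (fun w => C *+ 2 * \sum_i tail_cutoff n%:R (Z w 0 i)).
  exact: bounded_rv_scale.
have -> : e + C *+ 2 * \int[P1]_w (\sum_i tail_cutoff n%:R (Z w 0 i)) =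
    \int[P1]_w (e + C *+ 2 * \sum_i tail_cutoff n%:R (Z w 0 i)).
  rewrite RintegralD//; last 2 first.
  - exact/bounded_rv_integrable/bounded_rv_cst.
  - exact: bounded_rv_integrable.
  have -> : \int[P1]_w e = e.
    by rewrite Rintegral_cst// [X in fine X]probability_setT mulr1.
  rewrite RintegralZl//.
  exact: bounded_rv_integrable.
apply: Rintegral_dist_le.
- exact: bounded_rv_continuous.
- exact: bounded_rv_trig.
- by apply: bounded_rv_add => //; exact: bounded_rv_cst.
- by move=> w; exact: hf.
Qed.

Theorem cramer_wold : cvg_in_distribution P P' X Y.
Proof.
move=> h ch bh.
have bX r := bounded_rv_continuous (mX r) ch bh.
have bY := bounded_rv_continuous mY ch bh.
rewrite (eq_fun (fun r => bounded_rv_expectation (P r) (bX r))).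
rewrite bounded_rv_expectation//; apply: cvg_EFin; first exact: nearW.
have [C hC] := bh.
have C0 : 0 <= C by exact: le_trans (hC 0).
apply/cvgrPdist_lt => e e0.
(* Two approximation errors below [e' + 2 C e'] each and one distance below [e'] add up to less than
   [4 e' + 4 C e'], which is [e]. *)
pose e' := e / (4 + 4 * C).
have D0 : 0 < 4 + 4 * C by lra.
have e'0 : 0 < e' by rewrite divr_gt0.
have ee' : e = 4 * e' + 4 * (C * e').
  by rewrite /e'; field; rewrite gt_eqF.
(* The cutoff level is fixed by the limit [Y] alone; [cvg_cutoff] carries the bound over to [X r]
   for large [r]. *)
have [n In] : exists n : nat,
    \int[P']_w (\sum_i tail_cutoff n%:R (Y w 0 i)) < e'.
  have /cvgrPdist_lt/(_ _ e'0) H := cvg_cutoff0.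
  have [n] := filter_ex H; rewrite sub0r normrN => /(le_lt_trans (ler_norm _)).
  by exists n.
have [f tf hf] := trig_approx_cutoff n ch hC e'0.
near=> r.
have errX := Rintegral_trig_error (P r) (mX r) ch bh tf hf.
have errY := Rintegral_trig_error P' mY ch bh tf hf.
have cutX : \int[P r]_w (\sum_i tail_cutoff n%:R (X r w 0 i)) < e'.
  by near: r; exact: (cvgr_lt _ (@cvg_cutoff n)).
have trigX : `|\int[P']_w f (Y w) - \int[P r]_w f (X r w)| < e'.
  by near: r; have /cvgrPdist_lt/(_ _ e'0) := cvg_trig tf.
have CX := ler_wpM2l C0 (ltW cutX).
have CY := ler_wpM2l C0 (ltW In).
rewrite /= (le_lt_trans (ler_distD (\int[P']_w f (Y w)) _ _))//.
rewrite (le_lt_trans (lerD errY (ler_distD (\int[P r]_w f (X r w)) _ _)))//.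
rewrite [X in _ + (_ + X)]distrC.
rewrite (le_lt_trans (lerD (lexx _) (lerD (ltW trigX) errX)))//.
by lra.
Unshelve. all: by end_near. Qed.

End cramer_wold.
End random_vectors.

(** * Gaussian vectors *)

(** The linear form [t] of [X w *m B] is the form [t *m B^T] of [X w]. *)
Lemma gaussian_vector_linear (R : realType) d (T : measurableType d)
    (P : probability T R) m n (X : T -> 'rV[R]_m) (S : 'M[R]_m)
    (B : 'M[R]_(m, n)) :
  gaussian_vector P X S ->
  gaussian_vector P (fun w => X w *m B) (B^T *m S *m B).
Proof.
move=> [mX lawX]; split=> [i|t A mA].
  under eq_fun do rewrite mxE.
  by apply: measurable_sum => j; exact: measurable_funM.
have := lawX (t *m B^T) A mA.
by rewrite trmx_mul trmxK !mulmxA (funext (fun w => congr1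
  (fun M : 'M[R]_1 => M 0 0) (mulmxA (X w) B t^T))).
Qed.

Section gaussian_convergence.
Variables (R : realType) (d0 : measure_display) (T0 : measurableType d0).
Variables (P0 : probability T0 R) (Z : T0 -> R).
Hypothesis mZ : measurable_fun [set: T0] Z.
Hypothesis lawZ : forall (c : R) (A : set (measurableTypeR R)), measurable A ->
  pushforward P0 (fun w => c * Z w : measurableTypeR R) A =
  normal_law (c ^+ 2) A.

(** Both arguments of [psi] have the same law. Integrals on varying spaces thus move to the single
    space of [Z], the variance becoming a scale factor. *)
Lemma gaussian_vector_Rintegral d (T : measurableType d)
    (P : probability T R) N (X : T -> 'rV[R]_N) (S : 'M[R]_N) (t : 'rV[R]_N)
    (psi : R -> R) : gaussian_vector P X S -> 0 <= (t *m S *m t^T) 0 0 ->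
  continuous psi -> (exists C : R, forall x, `|psi x| <= C) ->
  \int[P]_w psi ((X w *m t^T) 0 0) =
  \int[P0]_w psi (Num.sqrt ((t *m S *m t^T) 0 0) * Z w).
Proof.
move=> [mX lawX] q0 cpsi bpsi.
apply: (@eq_law_Rintegral _ _ _ _ _ _ _ (fun w => (X w *m t^T) 0 0)
  (fun w => Num.sqrt ((t *m S *m t^T) 0 0) * Z w)) => //.
- exact: measurable_linear_form.
- by apply: measurable_funM => //; exact: measurable_cst.
by move=> A mA; rewrite (lawX t A mA) (@lawZ _ A mA) (sqr_sqrtr q0).
Qed.

(** Once on [P0], the integrands converge pointwise by continuity of [psi] and of the square root,
    also at variance 0. *)
Lemma gaussian_vector_cvg (d : nat -> measure_display)
    (T : forall r, measurableType (d r)) (P : forall r, probability (T r) R)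
    d' (T' : measurableType d') (P' : probability T' R) N
    (X : forall r, T r -> 'rV[R]_N) (Y : T' -> 'rV[R]_N)
    (S_ : nat -> 'M[R]_N) (S : 'M[R]_N) :
  (forall r, gaussian_vector (P r) (X r) (S_ r)) ->
  (forall r, covmx (S_ r)) -> gaussian_vector P' Y S -> covmx S ->
  (forall t : 'rV[R]_N,
    (t *m S_ r *m t^T) 0 0 @[r --> \oo] --> (t *m S *m t^T) 0 0) ->
  cvg_in_distribution P P' X Y.
Proof.
move=> gX cX gY cY S_S; apply: cramer_wold.
- by move=> r; have [] := gX r.
- by have [] := gY.
move=> t psi cpsi bpsi.
rewrite (gaussian_vector_Rintegral gY)//; last exact: cY.2.
rewrite (_ : (fun r => _) = (fun r =>
    \int[P0]_w psi (Num.sqrt ((t *m S_ r *m t^T) 0 0) * Z w))); last first.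
  apply/funext => r; rewrite (gaussian_vector_Rintegral (gX r))//.
  exact: (cX r).2.
have [C psiC] := bpsi.
apply: (@bounded_cvg_Rintegral _ _ _ _ _ _ C).
- move=> r; have [] // := @bounded_rv_comp _ _ _
    (fun w => Num.sqrt ((t *m S_ r *m t^T) 0 0) * Z w) psi _ cpsi bpsi.
  by apply: measurable_funM => //; exact: measurable_cst.
- by move=> r w; exact: psiC.
move=> w; apply: (@continuous_cvg _ _ _ _ _ _ psi); first exact: cpsi.
apply: cvgM; last exact: cvg_cst.
by apply: continuous_cvg; [exact: sqrt_continuous|exact: S_S].
Qed.

End gaussian_convergence.

(** The form [c *: delta_mx 0 i] has variance [c ^+ 2]; this provides the hypothesis [lawZ]. *)
Lemma gaussian_vector_coord (R : realType) d (T : measurableType d)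
    (P : probability T R) N (X : T -> 'rV[R]_N) (i : 'I_N) (c : R)
    (A : set (measurableTypeR R)) : gaussian_vector P X 1%:M ->
  measurable A ->
  pushforward P (fun w => c * X w 0 i : measurableTypeR R) A =
  normal_law (c ^+ 2) A.
Proof.
move=> [_ lawX] mA.
have xt (x : 'rV[R]_N) :
    (x *m (c *: delta_mx 0 i : 'rV[R]_N)^T) 0 0 = c * x 0 i.
  by rewrite linearZ/= -scalemxAr mxE mulmx_tr_delta.
have := lawX (c *: delta_mx 0 i) A mA.
rewrite mulmx1 xt mxE mxE !eqxx/= mulr1 -expr2 => <-.
by congr (pushforward P _ A); apply/funext => w; rewrite xt.
Qed.

(** * Covariance matrices: limits and factorization *)

Section covariance_matrices.
Variable R : realType.

Lemma covmx_gram m n (A : 'M[R]_(m, n)) : covmx (A^T *m A).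
Proof.
split=> [|t]; first by rewrite trmx_mul trmxK.
have -> : t *m (A^T *m A) *m t^T = t *m A^T *m (t *m A^T)^T.
  by rewrite trmx_mul trmxK !mulmxA.
by rewrite mxE sumr_ge0// => i _; rewrite [X in _ * X]mxE -expr2 sqr_ge0.
Qed.

Lemma quadratic_form_cvg n (S_ : nat -> 'M[R]_n) (S : 'M[R]_n) (t : 'rV[R]_n) :
  (forall i j, S_ r i j @[r --> \oo] --> S i j) ->
  (t *m S_ r *m t^T) 0 0 @[r --> \oo] --> (t *m S *m t^T) 0 0.
Proof.
move=> S_S.
have E (S' : 'M[R]_n) : (t *m S' *m t^T) 0 0 =
    \sum_j (\sum_i t 0 i * S' i j) * t 0 j.
  by rewrite mxE; apply: eq_bigr => j _; rewrite !mxE.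
rewrite E (funext (fun r => E (S_ r))).
apply: cvg_big; first exact: add_continuous.
move=> j _; apply: cvgM; last exact: cvg_cst.
apply: cvg_big; first exact: add_continuous.
by move=> i _; apply: cvgM; [exact: cvg_cst|exact: S_S].
Qed.

Lemma covmx_cvg n (S_ : nat -> 'M[R]_n) (S : 'M[R]_n) :
  (forall r, covmx (S_ r)) ->
  (forall i j, S_ r i j @[r --> \oo] --> S i j) -> covmx S.
Proof.
move=> cS S_S; split=> [|t].
  apply/matrixP => i j; rewrite mxE -(cvg_lim _ (S_S j i))//.
  apply: cvg_lim => //; rewrite (_ : (fun r => _) = (fun r => S_ r i j))//.
  by apply/funext => r; rewrite -[in LHS](cS r).1 mxE.
have qS : (t *m S_ r *m t^T) 0 0 @[r --> \oo] --> (t *m S *m t^T) 0 0.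
  exact: quadratic_form_cvg.
rewrite -(cvg_lim _ qS)//; apply: limr_ge.
  by apply/cvg_ex; exists ((t *m S *m t^T) 0 0).
by apply: nearW => r; exact: (cS r).2.
Qed.

Lemma quadratic_form_block n (a s : R) (b x : 'rV[R]_n) (D : 'M[R]_n) :
  (row_mx s%:M x *m block_mx a%:M b b^T D *m (row_mx s%:M x)^T) 0 0 =
  s ^+ 2 * a + (s * (b *m x^T) 0 0) *+ 2 + (x *m D *m x^T) 0 0.
Proof.
have bx : (x *m b^T) 0 0 = (b *m x^T) 0 0.
  by rewrite -[in LHS](trmxK x) -trmx_mul mxE.
have addE (A B : 'M[R]_1) : (A + B) 0 0 = A 0 0 + B 0 0 by rewrite mxE.
have scaleE c (A : 'M[R]_1) : (c *: A) 0 0 = c * A 0 0 by rewrite mxE.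
rewrite mul_row_block tr_row_mx mul_row_col !mulmxDl.
rewrite tr_scalar_mx !mul_mx_scalar !mul_scalar_mx -!scalemxAl.
rewrite !addE !scaleE bx [s%:M 0 0]mxE eqxx mulr1n.
by ring.
Qed.

(** The shape of one Cholesky step: the first row of the factor yields the pivot, its row and
    column, and the rank-one term [c^T *m c]. *)
Lemma block_mx_gram n (r : R) (c : 'rV[R]_n) (A : 'M[R]_n) :
  (block_mx r%:M c 0 A)^T *m block_mx r%:M c 0 A =
  block_mx (r ^+ 2)%:M (r *: c) (r *: c)^T (c^T *m c + A^T *m A).
Proof.
rewrite tr_block_mx mulmx_block tr_scalar_mx !trmx0 !mul0mx !mulmx0 !addr0.
by rewrite -scalar_mxM mul_scalar_mx mul_mx_scalar -expr2 [(r *: c)^T]linearZ.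
Qed.

(** Cholesky by induction on the size: with a positive pivot [a], the Schur complement [D'] is again
    a covariance matrix. *)
Lemma psd_factor n (S : 'M[R]_n) : covmx S -> exists A : 'M[R]_n, S = A^T *m A.
Proof.
elim: n S => [|n IH] S [symS psdS]; first by exists 0; apply/matrixP => -[].
pose S1 : 'M[R]_(1 + n) := S.
pose a := ulsubmx S1 0 0; pose b := ursubmx S1; pose D := drsubmx S1.
have SE : S = block_mx a%:M b b^T D :> 'M[R]_(1 + n).
  rewrite -[LHS](submxK S1) /a -mx11_scalar /b trmx_ursub.
  by rewrite [S1^T](symS : S1^T = S1).
have symD : D^T = D by rewrite /D trmx_drsub [S1^T](symS : S1^T = S1).
have q s (x : 'rV[R]_n) :
    0 <= s ^+ 2 * a + (s * (b *m x^T) 0 0) *+ 2 + (x *m D *m x^T) 0 0.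
  rewrite -quadratic_form_block -SE; exact: psdS.
have a0 : 0 <= a.
  have := q 1 0; rewrite trmx0 !mulmx0 mxE mulr0 mul0rn !addr0.
  by rewrite expr1n mul1r.
have [a_eq0|a_neq0] := eqVneq a 0.
  (* With [a = 0] the form is affine in its first variable, so nonnegativity forces the slope to
     vanish. *)
  have b0 : b = 0.
    apply/rowP => j; rewrite [RHS]mxE; apply/eqP; apply: contraT => bj.
    pose x : 'rV[R]_n := delta_mx 0 j.
    (* This value of the first variable would make the form equal to -1. *)
    have := q (- ((x *m D *m x^T) 0 0 + 1) / (b 0 j *+ 2)) x.
    rewrite a_eq0 mulr0 add0r (mulmx_tr_delta b) -mulrnAr -mulrA.
    rewrite mulVf ?mulr1; last by rewrite mulrn_eq0.
    by rewrite opprD addrAC addNr add0r oppr_ge0 ler10.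
  have [|A' DA'] := IH D.
    split=> // x; have := q 0 x.
    by rewrite expr0n/= !mul0r mul0rn !add0r.
  exists (block_mx 0%:M 0 0 A' : 'M[R]_(1 + n)).
  apply: (etrans SE); apply: esym; apply: (etrans (block_mx_gram 0 0 A')).
  by rewrite a_eq0 b0 -DA' expr0n scaler0 mulmx0 add0r.
have a_gt0 : 0 < a by rewrite lt_neqAle eq_sym a_neq0.
pose D' := D - a^-1 *: (b^T *m b).
have [|A' DA'] := IH D'.
  split=> [|x].
    by rewrite /D' linearB/= linearZ/= trmx_mul trmxK symD.
  have xb : (x *m (b^T *m b) *m x^T) 0 0 = (b *m x^T) 0 0 ^+ 2.
    rewrite mulmxA -mulmxA -[x in x *m b^T]trmxK -trmx_mul.
    by rewrite mxE big_ord1 mxE expr2.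
  (* - <b, x> / a minimizes the form in its first variable. *)
  have := q (- (b *m x^T) 0 0 / a) x.
  rewrite /D' mulmxBr mulmxBl -scalemxAr -scalemxAl.
  rewrite [X in _ -> 0 <= X]mxE [X in _ -> 0 <= _ + X]mxE.
  rewrite [X in _ -> 0 <= _ - X]mxE xb.
  by congr (0 <= _); field.
have sqrta0 : Num.sqrt a != 0 by rewrite sqrtr_eq0 -ltNge.
exists (block_mx (Num.sqrt a)%:M ((Num.sqrt a)^-1 *: b) 0 A' : 'M[R]_(1 + n)).
apply: (etrans SE); apply: esym; apply: (etrans (block_mx_gram _ _ A')).
rewrite sqr_sqrtr// scalerA divff// scale1r -DA' /D' linearZ/=.
rewrite [(_ *: b)^T]linearZ/= -scalemxAl scalerA -invfM -expr2 sqr_sqrtr//.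
by rewrite addrC subrK.
Qed.

End covariance_matrices.

(** * The tensor-variate process *)

(** Absolute convergence by comparison of [|x y|] with [x^2 + y^2], so that the [limn] in [ell2_dot]
    is a genuine limit. *)
Lemma ell2_dot_cvg (R : realType) (x y : nat -> R) : ell2 x -> ell2 y ->
  \sum_(i < r) x i * y i @[r --> \oo] --> ell2_dot x y.
Proof.
move=> x2 y2.
rewrite (_ : (fun r => _) = series (fun i => x i * y i)); last first.
  by apply/funext => r; rewrite seriesEord.
apply: normed_cvg.
apply: (@series_le_cvg _ _ (fun i => x i ^+ 2 + y i ^+ 2)).
- by move=> i /=; exact: normr_ge0.
- by move=> i; rewrite addr_ge0 ?sqr_ge0.
- move=> i /=; rewrite normrM -[x i ^+ 2]real_normK ?num_real//.
  rewrite -[y i ^+ 2]real_normK ?num_real//.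
  have := sqr_ge0 (`|x i| - `|y i|); have := normr_ge0 (x i).
  have := normr_ge0 (y i); nra.
rewrite (_ : series _ =
    series (fun i => x i ^+ 2) + series (fun i => y i ^+ 2)).
  exact: is_cvgD.
by rewrite -seriesD.
Qed.

Section tensor_features.
Variables (R : realType) (K d : nat) (U : 'I_K -> set 'rV[R]_d).
Variables (phi : 'rV[R]_d -> nat -> R) (n : 'I_K -> nat).
Unset Implicit Arguments.
Variable u : forall k, 'I_(n k) -> U k.

Let a r k (i : 'I_(n k)) (l : 'I_r) : R := phi (set_val (u k i)) l.
Set Implicit Arguments.
Local Notation cov_trunc r k := (cov_matrix (E := fun k : 'I_K => U k)
  (@Sigma_trunc R K d U phi r k) (u k)).
Local Notation cov_full k := (cov_matrix (E := fun k : 'I_K => U k)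
  (@Sigma_full R K d U phi k) (u k)).

Let SigmaE r : (fun k => cov_trunc r k) =
  (fun k => \matrix_(i, j) \sum_(l < r) a r k i l * a r k j l).
Proof.
apply: functional_extensionality_dep => k; apply/matrixP => i j.
by rewrite !mxE; apply: eq_bigr => l _; rewrite !mxE.
Qed.

Lemma covmx_Sigma_trunc r k :
  covmx (cov_trunc r k).
Proof.
pose A : 'M[R]_(r, n k) := \matrix_(l, i) a r k i l.
rewrite (_ : cov_trunc r k = A^T *m A); first exact: covmx_gram.
by apply/matrixP => i j; rewrite !mxE; apply: eq_bigr => l _; rewrite !mxE.
Qed.

Lemma covmx_kron_Sigma_trunc r :
  covmx (kron (fun k => cov_trunc r k)).
Proof.
by rewrite SigmaE; have [B _ ->] := kron_gram (a r); exact: covmx_gram.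
Qed.

Lemma tensor_normal_multilinear_fun r d' (T : measurableType d')
    (P : probability T R) (W : T -> tensor R (fun _ : 'I_K => r)) :
  tensor_normal P W (fun _ : 'I_K => 1%:M) ->
  tensor_normal P (fun w => eval_tensor (multilinear_fun (U := U) phi (W w)) u)
    (fun k => cov_trunc r k).
Proof.
move=> [_ gW]; split; first by move=> k; exact: covmx_Sigma_trunc.
rewrite SigmaE; have [B BE ->] := kron_gram (a r).
have [f _ fK] := vec_index_bij n.
(* Column [i] of [B] lists the products of features at grid point [i]; the identity covariance of
   [vec (W w)] then becomes [B^T *m B]. *)
rewrite (_ : (fun w => _) = (fun w => vec (W w) *m B)); last first.
  apply/funext => w; apply/rowP => p; rewrite -(fK p) vecE mxE sum_vec_index.
  rewrite /eval_tensor multilinear_funE; apply: eq_bigr => l _.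
  by rewrite vecE BE.
by have := gaussian_vector_linear B gW; rewrite kron1 mulmx1.
Qed.

Hypothesis phi_ell2 : forall v, ell2 (phi v).

Lemma Sigma_trunc_cvg k (i j : 'I_(n k)) :
  cov_trunc r k i j @[r --> \oo] -->
  cov_full k i j.
Proof.
rewrite mxE /Sigma_full.
rewrite (_ : (fun r => _) = (fun r => \sum_(l < r)
    phi (set_val (u k i)) l * phi (set_val (u k j)) l)).
  exact: ell2_dot_cvg.
by apply/funext => r; rewrite !mxE; apply: eq_bigr => l _; rewrite !mxE.
Qed.

Lemma kron_Sigma_trunc_cvg p q :
  kron (fun k => cov_trunc r k) p q
    @[r --> \oo] -->
  kron (fun k => cov_full k) p q.
Proof. by apply: kron_cvg => k i j; exact: Sigma_trunc_cvg. Qed.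

(** Infinitely many features give no finite Gram factor directly; positivity is inherited from the
    truncations. *)
Lemma covmx_Sigma_full k :
  covmx (cov_full k).
Proof.
apply: (@covmx_cvg _ _
  (fun r => cov_trunc r k)).
  by move=> r; exact: covmx_Sigma_trunc.
exact: Sigma_trunc_cvg.
Qed.

Lemma covmx_kron_Sigma_full :
  covmx (kron (fun k => cov_full k)).
Proof.
exact: covmx_cvg covmx_kron_Sigma_trunc kron_Sigma_trunc_cvg.
Qed.

End tensor_features.

(** [E] keeps the first [N] coordinates of [X], which are standard and independent; the factor [A]
    of [S] then gives them covariance [A^T *m A]. *)
Lemma gaussian_vector_exists (R : realType) d (T : measurableType d)
    (P : probability T R) m N (X : T -> 'rV[R]_m) (S : 'M[R]_N) :
  gaussian_vector P X 1%:M -> (N <= m)%N -> covmx S ->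
  exists Y : T -> 'rV[R]_N, gaussian_vector P Y S.
Proof.
move=> gX Nm /psd_factor[A ->].
pose E : 'M[R]_(m, N) := pid_mx N.
exists (fun w => X w *m (E *m A)).
have := gaussian_vector_linear (E *m A) gX.
rewrite mulmx1 trmx_mul -mulmxA (mulmxA E^T) tr_pid_mx mul_pid_mx.
by rewrite minnn (minn_idPr Nm) pid_mx_1 mul1mx.
Qed.

Theorem theorem1 (R : realType) (K d : nat) (K_gt0 : (0 < K)%N)
    (d_gt0 : (0 < d)%N) (U : 'I_K -> set 'rV[R]_d)
    (phi : 'rV[R]_d -> nat -> R) (phi_ell2 : forall u, ell2 (phi u))
    (disp : nat -> measure_display)
    (Omega : forall r, measurableType (disp r))
    (P : forall r, probability (Omega r) R)
    (W : forall r, Omega r -> tensor R (fun _ : 'I_K => r))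
    (W_normal : forall r, tensor_normal (P r) (W r) (fun _ : 'I_K => 1%:M)) :
  (forall r, tensor_gaussian_process (P r)
    (fun w => multilinear_fun (U := U) phi (W r w))
    (Sigma_trunc (U := U) phi r)) /\
  cvg_to_tensor_gaussian_process P
    (fun r w => multilinear_fun (U := U) phi (W r w))
    (Sigma_full (U := U) phi).
Proof.
have gW r : gaussian_vector (P r) (fun w => vec (W r w)) 1%:M.
  by have [_] := W_normal r; rewrite kron1.
split=> [r n u|n u]; first exact: tensor_normal_multilinear_fun.
have psdS := covmx_kron_Sigma_full u phi_ell2.
split.
  set N := (\prod_(k < K) n k)%N in psdS *.
  (* [W N] has [N ^ K] entries, at least [N] because [K] is positive, so its space carries the limit
     law. *)
  have Nm : (N <= \prod_(k < K) N)%N.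
    rewrite prod_nat_const card_ord; case: (K) K_gt0 => // K' _.
    by case: (N) => // N'; rewrite expnS leq_pmulr// expn_gt0.
  have [Y gY] := gaussian_vector_exists (gW N) Nm psdS.
  exists (disp N), (Omega N), (P N), (fun w i => Y w 0 (vec_index i)).
  split; first by move=> k; exact: covmx_Sigma_full.
  rewrite (_ : (fun w => _) = Y)//.
  have [f _ fK] := vec_index_bij n.
  by apply/funext => w; apply/rowP => p; rewrite -(fK p) vecE.
move=> d' T' P' M [_ gM].
(* The single entry of [W 1] is the standard Gaussian reference variable [Z]. *)
have i0 : 'I_(\prod_(k < K) 1) by rewrite prod_nat_const exp1n; exact: ord0.
have [mW _] := gW 1%N.
apply: (gaussian_vector_cvg (P0 := P 1%N) (Z := fun w => vec (W 1%N w) 0 i0)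
  (S_ := fun r => kron (fun k => cov_matrix (E := fun k : 'I_K => U k)
    (@Sigma_trunc R K d U phi r k) (u k)))
  _ _ _ _ gM).
- exact: mW.
- by move=> c A mA; exact: (gaussian_vector_coord i0 c (gW 1%N)).
- by move=> r; have [] := tensor_normal_multilinear_fun phi u (W_normal r).
- by move=> r; exact: covmx_kron_Sigma_trunc.
- exact: psdS.
- by move=> t; apply: quadratic_form_cvg => p q; exact: kron_Sigma_trunc_cvg.
Qed.
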